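(* Let $(P,\eta,H,M,F)$ be a constrained Hamiltonian system satisfying the mechanical condition $\mathrm{d}H|_M\in({}^{\bot}F)^{\circ}$, with ${}^{\bot}F\cap TM=\{0\}$ and $\operatorname{rank}(F)=\dim(M)$. Then the nonholonomic bracket $\{\cdot,\cdot\}_{H,M}$ endows $C^\infty(M)$ with an almost Lie algebra structure (it is $\mathbb{R}$-bilinear and skew-symmetric) satisfying the generalized Leibniz rule $$\{f,gh\}_{H,M}=g\{f,h\}_{H,M}+h\{f,g\}_{H,M}-gh\,\mathcal{R}_{H,M}(f)$$ for all $f,g,h\in C^\infty(M)$.
   Context: A contact manifold $(P,\eta)$ of dimension $2n+1$ is a manifold with a $1$-form $\eta$ such that $\eta\wedge(\mathrm{d}\eta)^n$ is a volume form. The map $\flat:TP\to T^*P$, $\flat(v)=\iota_v\mathrm{d}\eta+\eta(v)\eta$, is a vector bundle isomorphism with inverse $\sharp$. The Reeb vector field $\mathcal{R}$ is determined by $\iota_{\mathcal{R}}\mathrm{d}\eta=0$, $\eta(\mathcal{R})=1$. The Jacobi bivector of $\eta$ is $\Lambda(\alpha,\beta)=-\mathrm{d}\eta(\sharp\alpha,\sharp\beta)$. A constrained Hamiltonian system $(P,\eta,H,M,F)$ consists of a contact manifold, a smooth function $H:P\to\mathbb{R}$, an embedded submanifold $M\subseteq P$ and a vector subbundle $F$ of $T_MP$ (the restriction of $TP$ to $M$). $(\cdot)^{\circ}$ denotes the annihilator in $T^*_MP$, and ${}^{\bot}F=\sharp(F^{\circ})$. Under the hypotheses, $T_MP={}^{\bot}F\oplus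 TM$; let $\mathcal{P}:T_MP\to TM$ be the associated projection and $\mathcal{P}^*(\alpha)=\alpha\circ\mathcal{P}$ its adjoint. Put $\mathcal{R}_{H,M}=\mathcal{P}(\mathcal{R}|_M)\in\mathfrak{X}(M)$ and $\Lambda_{H,M}(\alpha,\beta)=\Lambda(\mathcal{P}^*\alpha,\mathcal{P}^*\beta)$ for $x\in M$, $\alpha,\beta\in T_x^*P$; this depends only on the restrictions of $\alpha,\beta$ to $T_xM$, so $\Lambda_{H,M}$ is a bivector field on $M$. The nonholonomic bracket of $f,g\in C^\infty(M)$ is $\{f,g\}_{H,M}=\Lambda_{H,M}(\mathrm{d}f,\mathrm{d}g)-f\,\mathcal{R}_{H,M}(g)+g\,\mathcal{R}_{H,M}(f)$. *)

(* Defs.v *)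
From HB Require Import structures.
From mathcomp Require Export all_boot all_order all_algebra all_fingroup.
From mathcomp Require Export all_classical all_reals all_analysis.
Export Order.TTheory GRing.Theory Num.Theory numFieldNormedType.Exports.

Set Implicit Arguments.
Unset Strict Implicit.
Unset Printing Implicit Defensive.

Local Open Scope classical_set_scope.
Local Open Scope ring_scope.

Section Smooth.
Context {R : realType}.

(* Meant for open [U]. In finite dimension, "the Frechet derivative of f is
   C^k" amounts to "every directional derivative of f is C^k". *)
Fixpoint Ck_on (V W : normedModType R) (k : nat) (U : set V) (f : V -> W)
    : Prop :=
  match k with
  | 0 => forall x, U x -> {for x, continuous f}
  | k'.+1 => (forall x, U x -> differentiable f x) /\
             (forall v, Ck_on k' U ('D_v f))
  end.

Definition smooth_on (V W : normedModType R) (U : set V) (f : V -> W) : Prop :=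
  forall k, Ck_on k U f.

End Smooth.

(* [chart_map] and [chart_inv] are total functions, meaningful only on
   [chart_dom] and [chart_cod] respectively. *)
Record chart (R : realType) (m : nat) (T : topologicalType) := Chart {
  chart_dom : set T;
  chart_cod : set 'rV[R]_m;
  chart_map : T -> 'rV[R]_m;
  chart_inv : 'rV[R]_m -> T;
  chart_dom_open : open chart_dom;
  chart_cod_open : open chart_cod;
  chart_mapK : forall x, chart_dom x ->
    chart_cod (chart_map x) /\ chart_inv (chart_map x) = x;
  chart_invK : forall z, chart_cod z ->
    chart_dom (chart_inv z) /\ chart_map (chart_inv z) = z;
  chart_map_cts : forall x, chart_dom x -> {for x, continuous chart_map};
  chart_inv_cts : forall z, chart_cod z -> {for z, continuous chart_inv}
}.

(* The atlas is indexed by the points of the manifold: one chart is selected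
   around each point. Every smooth structure is determined by such an atlas,
   and the selected chart at [x] identifies T_xP with 'rV[R]_m. *)
Record smooth_manifold (R : realType) (m : nat) := SmoothManifold {
  mcarrier :> topologicalType;
  mf_hausdorff : hausdorff_space mcarrier;
  mf_second_countable : @second_countable mcarrier;
  chart_at : mcarrier -> chart R m mcarrier;
  mem_chart_at : forall x, chart_dom (chart_at x) x;
  chart_compat : forall x y,
    smooth_on (chart_cod (chart_at x) `&`
               chart_inv (chart_at x) @^-1` chart_dom (chart_at y))
              (chart_map (chart_at y) \o chart_inv (chart_at x))
}.

Section ManifoldCalculus.
Context {R : realType}.

Definition smooth_fun_on (m : nat) (P : smooth_manifold R m)
    (W : normedModType R) (U : set P) (f : P -> W) : Prop :=
  forall x, smooth_on (chart_cod (chart_at x) `&` chart_inv (chart_at x) @^-1` U)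
                      (f \o chart_inv (chart_at x)).

Definition Cinf (m : nat) (P : smooth_manifold R m) : set (P -> R^o) :=
  [set f | smooth_fun_on setT f].

Definition smooth_map (m k : nat) (M : smooth_manifold R k)
    (P : smooth_manifold R m) (f : M -> P) : Prop :=
  continuous f /\
  forall x, smooth_on
    (chart_cod (chart_at x) `&`
     chart_inv (chart_at x) @^-1` (f @^-1` chart_dom (chart_at (f x))))
    (chart_map (chart_at (f x)) \o f \o chart_inv (chart_at x)).

(* The tangent space T_xP is 'rV[R]_m, the components of a tangent vector being
   taken in [chart_at x]; the cotangent space T*_xP is 'Hom('rV[R]_m, R^o). *)

Definition mdiff (m k : nat) (M : smooth_manifold R k)
    (P : smooth_manifold R m) (f : M -> P) (x : M)
    : 'Hom('rV[R]_k, 'rV[R]_m) :=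
  linfun ('d (chart_map (chart_at (f x)) \o f \o chart_inv (chart_at x))
             (chart_map (chart_at x) x)).

Definition mdf (m : nat) (P : smooth_manifold R m) (f : P -> R^o) (x : P)
    : 'Hom('rV[R]_m, R^o) :=
  linfun ('d (f \o chart_inv (chart_at x)) (chart_map (chart_at x) x)).

(* Change of components, from [chart_at x] to [chart_at y], of tangent vectors
   at a point [z] in the domain of both charts. *)
Definition tchange (m : nat) (P : smooth_manifold R m) (x y z : P)
    : 'End('rV[R]_m) :=
  linfun ('d (chart_map (chart_at y) \o chart_inv (chart_at x))
             (chart_map (chart_at x) z)).

Definition embedding (m k : nat) (M : smooth_manifold R k)
    (P : smooth_manifold R m) (i : M -> P) : Prop :=
  [/\ smooth_map i,
      forall x, lker (mdiff i x) = 0%VS,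
      injective i &
      forall A : set M, open A -> exists2 B : set P, open B & A = i @^-1` B].

Definition one_form (m : nat) (P : smooth_manifold R m) : Type :=
  P -> 'Hom('rV[R]_m, R^o).

(* Value of [eta] on the constant coordinate field [v] of [chart_at x], as a
   function of the coordinates. *)
Definition form_in_chart (m : nat) (P : smooth_manifold R m)
    (eta : one_form P) (x : P) (v : 'rV[R]_m) : 'rV[R]_m -> R^o :=
  fun z => let y := chart_inv (chart_at x) z in eta y (tchange x y y v).

Definition smooth_form (m : nat) (P : smooth_manifold R m)
    (eta : one_form P) : Prop :=
  forall x v, smooth_on (chart_cod (chart_at x)) (form_in_chart eta x v).

(* d eta (X, Y) = X (eta Y) - Y (eta X) - eta [X, Y], on the commuting
   coordinate fields u, v of [chart_at x]. *)
Definition dform (m : nat) (P : smooth_manifold R m) (eta : one_form P) (x : P)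
    (u v : 'rV[R]_m) : R :=
  'D_u (form_in_chart eta x v) (chart_map (chart_at x) x) -
  'D_v (form_in_chart eta x u) (chart_map (chart_at x) x).

End ManifoldCalculus.

Section Wedge.
Context {R : realType} {V : Type}.

(* Multilinearity and alternation are not imposed: [pform] is only applied to
   genuine p-covectors. *)
Definition pform (p : nat) : Type := ('I_p -> V) -> R.

(* Determinant convention: dx /\ dy = dx (x) dy - dy (x) dx. *)
Definition wedge (p q : nat) (a : pform p) (b : pform q) : pform (p + q) :=
  fun v => (p`!%:R * q`!%:R)^-1 *
    \sum_(s : 'S_(p + q)) (-1) ^+ s *
      (a (fun i => v (s (lshift q i))) * b (fun j => v (s (rshift p j)))).

Fixpoint wedge_pow (w : pform 2) (n : nat) : pform (n * 2) :=
  match n with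
  | 0 => fun _ => 1
  | n'.+1 => wedge w (@wedge_pow w n')
  end.

End Wedge.

Arguments wedge_pow {R V} w n v.

Section Contact.
Context {R : realType}.

Definition is_contact_form (n : nat) (P : smooth_manifold R (1 + n * 2))
    (eta : one_form P) : Prop :=
  forall x : P, exists v : 'I_(1 + n * 2) -> 'rV[R]_(1 + n * 2),
    wedge (fun w : 'I_1 -> _ => eta x (w ord0) : R)
          (wedge_pow (fun w : 'I_2 -> _ => dform eta x (w ord0) (w ord_max)) n)
          v != 0.

End Contact.

Record contact_manifold (R : realType) (n : nat) := ContactManifold {
  cm_manifold :> smooth_manifold R (1 + n * 2);
  contact_form : one_form cm_manifold;
  contact_form_smooth : smooth_form contact_form;
  contact_form_contact : is_contact_form contact_form
}.

Arguments contact_form {R n} c x.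

Section ContactGeometry.
Context {R : realType} {n : nat} (P : contact_manifold R n).
Local Notation V := 'rV[R]_(1 + n * 2).
Local Notation eta := (contact_form P).

Definition flat (x : P) : 'Hom(V, 'Hom(V, R^o)) :=
  linfun (fun v => linfun (fun w => dform eta x v w + eta x v * eta x w : R^o)).

(* [flat x] is bijective on a contact manifold, so this is its inverse. *)
Definition sharp (x : P) : 'Hom('Hom(V, R^o), V) := (flat x)^-1%VF.

Definition reeb (x : P) : V :=
  xget 0 [set v | (forall w, dform eta x v w = 0) /\ eta x v = 1].

Definition jacobi (x : P) (a b : 'Hom(V, R^o)) : R :=
  - dform eta x (sharp x a) (sharp x b).

End ContactGeometry.

(* [F x] is a subspace of T_(i x)P. The sections [s j] are vector fields along
   [i], whose smoothness is read in the chart selected at [i x0]. *)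
Definition is_subbundle {R : realType} (m k : nat) (M : smooth_manifold R k)
    (P : smooth_manifold R m) (i : M -> P) (r : nat)
    (F : M -> {vspace 'rV[R]_m}) : Prop :=
  forall x0 : M, exists (U : set M) (s : 'I_r -> M -> 'rV[R]_m),
    [/\ open U, U x0,
        U `<=` i @^-1` chart_dom (chart_at (i x0)),
        forall j, smooth_fun_on U (fun y => tchange (i y) (i x0) (i y) (s j y)) &
        forall y, U y -> basis_of (F y) [seq s j y | j <- enum 'I_r]].

(* A covector annihilates F iff its composite with a projection onto F is 0. *)
Definition annihilator {R : realType} {V : vectType R} (F : {vspace V})
    : {vspace 'Hom(V, R^o)} :=
  lker (linfun (fun a : 'Hom(V, R^o) => (a \o projv F)%VF)).

Lemma annihilatorP (R : realType) (V : vectType R) (F : {vspace V})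
    (a : 'Hom(V, R^o)) :
  a \in annihilator F <-> (forall v, v \in F -> a v = 0).
Proof.
pose f := fun a : 'Hom(V, R^o) => (a \o projv F)%VF.
have lf : linear f.
  by move=> c u w; apply/lfunP => v; rewrite /f !lfunE /= !lfunE /= !lfunE.
pose fl : {linear _ -> _} := HB.pack f (GRing.isLinear.Build _ _ _ _ f lf).
rewrite /annihilator memv_ker (_ : linfun _ = linfun fl)// lfunE /=.
split=> [/eqP /lfunP h v vF|h].
  by have := h v; rewrite comp_lfunE zero_lfunE projv_id.
by apply/eqP/lfunP => v; rewrite comp_lfunE zero_lfunE h// memv_proj.
Qed.

(* The constraint submanifold M of P is given with its inclusion [incl]; k is
   the dimension of M and r the rank of F. *)
Record constrained_system (R : realType) (n k r : nat) := ConstrainedSystem {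
  cs_contact :> contact_manifold R n;
  ham : cs_contact -> R^o;
  ham_smooth : Cinf ham;
  cs_sub : smooth_manifold R k;
  incl : cs_sub -> cs_contact;
  incl_embedding : embedding incl;
  cs_bundle : cs_sub -> {vspace 'rV[R]_(1 + n * 2)};
  cs_bundle_sub : is_subbundle incl r cs_bundle
}.

Arguments ham {R n k r} c x.
Arguments incl {R n k r} c x.
Arguments cs_bundle {R n k r} c x.

Section Bracket.
Context {R : realType} {n k r : nat} (S : constrained_system R n k r).
Local Notation M := (cs_sub S).
Local Notation V := 'rV[R]_(1 + n * 2).

Definition perp (x : M) : {vspace V} :=
  (sharp (incl S x) @: annihilator (cs_bundle S x))%VS.

(* T_xM as a subspace of T_xP *)
Definition tangent_sub (x : M) : {vspace V} := limg (mdiff (incl S) x).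

Definition mechanical : Prop :=
  forall x : M, mdf (ham S) (incl S x) \in annihilator (perp x).

(* The projection onto T_xM along [perp x], followed by the inverse of the
   injection d(incl) : T_xM -> T_(incl x)P, so as to land in T_xM = 'rV[R]_k. *)
Definition cproj (x : M) : 'Hom(V, 'rV[R]_k) :=
  ((mdiff (incl S) x)^-1 \o daddv_pi (tangent_sub x) (perp x))%VF.

Definition reebHM (x : M) : 'rV[R]_k := cproj x (reeb (incl S x)).

Definition lambdaHM (x : M) (a b : 'Hom('rV[R]_k, R^o)) : R :=
  jacobi (incl S x) (a \o cproj x)%VF (b \o cproj x)%VF.

Definition reebHM_der (f : M -> R^o) : M -> R^o :=
  fun x => mdf f x (reebHM x).

Definition nh_bracket (f g : M -> R^o) : M -> R^o :=
  fun x => lambdaHM x (mdf f x) (mdf g x)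
           - f x * reebHM_der g x + g x * reebHM_der f x.

End Bracket.

(* [br] restricts to an R-bilinear skew-symmetric operation on the linear
   subspace C *)
Definition almost_lie_algebra {R : realType} (E : lmodType R) (C : set E)
    (br : E -> E -> E) : Prop :=
  [/\ forall f g, C f -> C g -> C (br f g),
      forall (a : R) f g h, C f -> C g -> C h ->
        br (a *: f + g) h = a *: br f h + br g h,
      forall (a : R) f g h, C f -> C g -> C h ->
        br f (a *: g + h) = a *: br f g + br f h &
      forall f g, C f -> C g -> br f g = - br g f].

(* Main.v *)
From HB Require Import structures.
Require Import Defs.
From mathcomp Require Import ring lra.
Set Implicit Arguments.
Unset Strict Implicit.
Unset Printing Implicit Defensive.

Local Open Scope classical_set_scope.
Local Open Scope ring_scope.

(** The bracket is a first-order bidifferential operator whose symbol is the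
    skew form [lambdaHM]: skew-symmetry comes from that of [d eta], bilinearity
    and the generalized Leibniz rule from the linearity of [df] in [f], from the
    product rule for [d(gh)] and from the explicit terms in [reebHM]. These
    identities hold pointwise. What remains, and carries almost all the work, is
    that the bracket of two smooth functions is smooth.

    At each point of the submanifold the bracket is defined with components taken
    in the charts selected at that point and at its image, which vary without
    any regularity. Around a point [x] all the data are therefore transported to
    the charts selected at [x] and at its image, by means of the cocycle
    [tchange] of the transition maps. For [d eta] this transport is the
    naturality of the exterior derivative ([dform_change]), which rests on the
    symmetry of second derivatives ([schwarz]).

    In fixed charts everything is a matrix with smooth entries. Let [A] and [B]
    be the components of [eta] and [d eta], [J] the Jacobian matrix of the
    inclusion, and [F] a matrix whose rows are a local frame of the constraint
    bundle. Then [G = B + A A^T] is the matrix of [flat], and the row vector of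
    the Reeb field is [A^T G^-1] since this field is [sharp eta]. A vector [u]
    is in [perp] iff [u G F^T = 0], so the projection onto the submanifold has
    the matrix [N = G F^T (J G F^T)^-1] ([cproj_mx]), and the bracket is a
    polynomial in the entries of [A], [B], [G^-1], [N], in the two functions and
    in their partial derivatives ([nh_bracket_mx]). Two matrices have to be inverted, and
    Cramer's rule makes their inverses smooth ([smooth_mxV]).

    [G] is invertible because of the contact condition: a vector killed by [eta]
    and [d eta] is a null vector of the top-degree form [eta /\ (d eta)^n], which
    would then vanish ([contact_nondegenerate]). The existence of the Reeb vector
    uses in addition that a skew form on an odd-dimensional space is degenerate
    ([reeb_spec]). The square matrix [J G F^T] is invertible by transversality
    ([pairing_unit]). *)

(** * Calculus of smooth functions *)

(** The difference of the two functions is zero near [a], hence differentiable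
    there with zero differential. *)
Lemma near_eq_differentiable (R : realType) (V W : normedModType R)
    (f g : V -> W) (a : V) :
  {near a, f =1 g} -> differentiable f a -> differentiable g a.
Proof.
move=> fg df; have -> : g = f + (g - f) by rewrite addrC subrK.
apply: differentiableD => //.
set h := g - f.
have h0 : \near a, h a = 0.
  by near=> z; rewrite /h -[LHS]/(g z - f z) (near fg z)// subrr.
have ha : h a = 0 by exact: nbhs_singleton h0.
pose z0 : {linear V -> W} := \0.
have z0c : continuous z0 by apply: cst_continuous.
have eh : h \o shift a = cst (h a) + z0 +o_ 0 id.
  apply/eqaddoP => e e0; rewrite near_simpl.
  have : \forall x \near 0, h (x + a) = 0.
    by move: h0; rewrite (near_shift 0)/=; apply: filterS => x /=; rewrite subr0.
  apply: filterS => x hx.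
  rewrite -[(_ - _) x]/(h (x + a) - (h a + 0)) hx ha addr0 subr0 normr0.
  by rewrite mulr_ge0// ltW.
apply/diff_locallyP.
by rewrite (diff_unique z0c eh).
Unshelve. all: by end_near. Qed.

Lemma near_eq_diff (R : realType) (V W : normedModType R)
    (f g : V -> W) (a : V) :
  {near a, f =1 g} -> differentiable f a -> 'd f a = 'd g a :> (V -> W).
Proof.
move=> fg df; apply/funext => v; rewrite -!deriveE//.
  exact: near_eq_derive.
exact: near_eq_differentiable fg df.
Qed.

Lemma open_near (T : topologicalType) (U : set T) x : open U -> U x -> \near x, U x.
Proof. by move=> oU Ux; apply: open_nbhs_nbhs. Qed.

Section Ck.
Context {R : realType}.
Implicit Types V W : normedModType R.

(** The unfolding of [Ck_on] at a successor that keeps the derivatives folded. *)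
Lemma Ck_onS V W k (U : set V) (f : V -> W) : Ck_on k.+1 U f ->
  (forall x, U x -> differentiable f x) /\ (forall v, Ck_on k U ('D_v f)).
Proof. by []. Qed.

Lemma Ck_onW V W k (U : set V) (f : V -> W) : Ck_on k.+1 U f -> Ck_on k U f.
Proof.
elim: k f => [|k IH] f /= [df Df].
  by move=> x /df; exact: differentiable_continuous.
by split=> // v; apply: IH.
Qed.

Lemma Ck_on_sub V W k (U U' : set V) (f : V -> W) : U' `<=` U ->
  Ck_on k U f -> Ck_on k U' f.
Proof.
move=> sU; elim: k f => [|k IH] f /=; first by move=> h x /sU; exact: h.
by move=> [df Df]; split=> [x /sU /df//|v]; exact: IH.
Qed.

Lemma Ck_on_eq V W k (U : set V) (f g : V -> W) : open U ->
  (forall x, U x -> f x = g x) -> Ck_on k U f -> Ck_on k U g.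
Proof.
move=> oU; elim: k f g => [|k IH] f g fg /=.
  move=> cf x Ux; rewrite /prop_for /continuous_at -(fg x Ux).
  apply: cvg_trans (cf _ Ux); apply: near_eq_cvg.
  by apply: filterS (open_near oU Ux) => y; exact: fg.
have nfg x : U x -> {near x, f =1 g}.
  by move=> Ux; apply: filterS (open_near oU Ux) => y; exact: fg.
move=> [df Df]; split=> [x Ux|v].
  by apply: near_eq_differentiable (nfg x Ux) (df x Ux).
by apply: IH (Df v) => x Ux; apply: near_eq_derive; exact: nfg.
Qed.

Lemma Ck_on_cst V W k (U : set V) (c : W) : Ck_on k U (cst c).
Proof.
elim: k c => [|k IH] c /=; first by move=> x _; exact: cst_continuous.
split=> [x _|v]; first exact: differentiable_cst.
rewrite (_ : 'D_v (cst c) = cst 0); first exact: IH.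
by apply/funext => x; rewrite derive_cst.
Qed.

Lemma Ck_onD V W k (U : set V) (f g : V -> W) : open U ->
  Ck_on k U f -> Ck_on k U g -> Ck_on k U (fun x => f x + g x).
Proof.
move=> oU; elim: k f g => [|k IH] f g /=.
  by move=> cf cg x Ux; apply: continuousD; [exact: cf|exact: cg].
move=> [df Df] [dg Dg]; split=> [x Ux|v].
  by apply: differentiableD; [exact: df|exact: dg].
apply: (@Ck_on_eq _ _ _ _ (fun x => 'D_v f x + 'D_v g x)) => //; last exact: IH.
move=> x Ux; rewrite -deriveD//; apply: diff_derivable; [exact: df|exact: dg].
Qed.

Lemma Ck_on_sum V W k (U : set V) (I : Type) (r : seq I) (P : pred I)
    (f : I -> V -> W) : open U ->
  (forall i, P i -> Ck_on k U (f i)) ->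
  Ck_on k U (fun x => \sum_(i <- r | P i) f i x).
Proof.
move=> oU Cf; elim: r => [|i r IH].
  by under eq_fun do rewrite big_nil; exact: Ck_on_cst.
under eq_fun do rewrite big_cons.
case Pi: (P i) => //; apply: Ck_onD => //; exact: Cf.
Qed.

Lemma Ck_on_lin V W W' k (U : set V) (f : V -> W) (L : {linear W -> W'}) :
  open U -> continuous L -> Ck_on k U f -> Ck_on k U (L \o f).
Proof.
move=> oU cL; elim: k f => [|k IH] f /=.
  by move=> cf x Ux; apply: continuous_comp; [exact: cf|exact: cL].
move=> [df Df]; have dL y : differentiable L y by exact: linear_differentiable.
split=> [x Ux|v]; first by apply: differentiable_comp => //; exact: df.
apply: (@Ck_on_eq _ _ _ _ (L \o 'D_v f)) => //; last exact: IH.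
move=> x Ux; rewrite /= [in RHS]deriveE; last first.
  by apply: differentiable_comp => //; exact: df.
by rewrite diff_comp//=; [rewrite diff_lin// deriveE//; exact: df|exact: df].
Qed.

Lemma Ck_onM V k (U : set V) (f g : V -> R^o) : open U ->
  Ck_on k U f -> Ck_on k U g -> Ck_on k U (fun x => f x * g x : R^o).
Proof.
move=> oU; elim: k f g => [|k IH] f g.
  by move=> /= cf cg x Ux; apply: continuousM; [exact: cf|exact: cg].
move=> Cf Cg; have [df Df] := Ck_onS Cf; have [dg Dg] := Ck_onS Cg; split=> [x Ux|v].
  by apply: differentiableM; [exact: df|exact: dg].
apply: (@Ck_on_eq _ _ _ _ (fun x => f x * 'D_v g x + g x * 'D_v f x : R^o)) => //.
  move=> x Ux; rewrite [in RHS]deriveM//; apply: diff_derivable; [exact: df|exact: dg].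
by apply: Ck_onD => //; (apply: IH; [exact: Ck_onW|]).
Qed.

Lemma Ck_on_inv V k (U : set V) (f : V -> R^o) : open U ->
  (forall x, U x -> f x != 0) ->
  Ck_on k U f -> Ck_on k U (fun x => (f x)^-1 : R^o).
Proof.
move=> oU f0; elim: k => [|k IH].
  by move=> /= cf x Ux; apply: continuousV; [exact: f0|exact: cf].
move=> Cf; have [df Df] := Ck_onS Cf; split=> [x Ux|v].
  by apply: differentiableV; [exact: df|exact: f0].
apply: (@Ck_on_eq _ _ _ _ (fun x => (-1) * ((f x)^-1 * (f x)^-1 * 'D_v f x) : R^o)) => //.
  move=> x Ux; rewrite [in RHS]deriveV//; last by apply: diff_derivable; exact: df.
    by rewrite mulN1r scaleNr -invfM -expr2.
  exact: f0.
have := IH (Ck_onW Cf) => iC.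
apply: Ck_onM => //; first exact: Ck_on_cst.
by apply: Ck_onM => //; apply: Ck_onM.
Qed.

Lemma Ck_on_coord V m n k (U : set V) (f : V -> 'M[R]_(m, n)) i j : open U ->
  Ck_on k U f -> Ck_on k U (fun x => f x i j : R^o).
Proof.
move=> oU Cf.
have lc : linear (fun N : 'M[R]_(m, n) => N i j : R^o) by move=> a u v; rewrite !mxE.
pose L : {linear 'M[R]_(m, n) -> R^o} := HB.pack (fun N : 'M[R]_(m, n) => N i j : R^o)
  (GRing.isLinear.Build _ _ _ _ _ lc).
by apply: (@Ck_on_lin _ _ _ _ _ _ L) => //; exact: coord_continuous.
Qed.

Lemma derive_comp_row V m (f : V -> 'rV[R]_m) (g : 'rV[R]_m -> R^o) x v :
  differentiable f x -> differentiable g (f x) ->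
  'D_v (g \o f) x = \sum_j 'D_v f x 0 j * 'D_('e_j) g (f x).
Proof.
move=> df dg; rewrite deriveE; last exact: differentiable_comp.
rewrite diff_comp//= -(deriveE v df) {1}['D_v f x]row_sum_delta linear_sum.
by apply: eq_bigr => j _; rewrite linearZ/= (deriveE _ dg).
Qed.

(** Chain rule and induction on the order: a derivative of [g \o f] is a sum of
    products of derivatives of [f] and of partial derivatives of [g] composed
    with [f], so [g] has to be generalized in the induction. *)
Lemma Ck_on_comp V m k (U : set V) (U' : set 'rV[R]_m)
    (f : V -> 'rV[R]_m) (g : 'rV[R]_m -> R^o) : open U ->
  (forall x, U x -> U' (f x)) ->
  Ck_on k U f -> Ck_on k U' g -> Ck_on k U (g \o f).
Proof.
move=> oU fU; elim: k f g fU => [|k IH] f g fU.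
  by move=> /= cf cg x Ux; apply: continuous_comp; [exact: cf|apply: cg; exact: fU].
move=> Cf Cg; have [df Df] := Ck_onS Cf; have [dg Dg] := Ck_onS Cg.
split=> [x Ux|v].
  by apply: differentiable_comp; [exact: df|apply: dg; exact: fU].
apply: (@Ck_on_eq _ _ _ _ (fun x => \sum_j 'D_v f x 0 j * 'D_('e_j) g (f x))) => //.
  by move=> x Ux; rewrite derive_comp_row//; [exact: df|apply: dg; exact: fU].
apply: Ck_on_sum => // j _; apply: Ck_onM => //.
  by apply: Ck_on_coord.
by apply: (IH f ('D_('e_j) g)) => //; exact: Ck_onW.
Qed.

End Ck.

Section Smooth.
Context {R : realType}.
Implicit Types V W : normedModType R.

Lemma smooth_on_sub V W (U U' : set V) (f : V -> W) : U' `<=` U ->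
  smooth_on U f -> smooth_on U' f.
Proof. by move=> sU sf k; apply: Ck_on_sub sU _. Qed.

Lemma smooth_on_eq V W (U : set V) (f g : V -> W) : open U ->
  (forall x, U x -> f x = g x) -> smooth_on U f -> smooth_on U g.
Proof. by move=> oU fg sf k; apply: Ck_on_eq fg _. Qed.

Lemma smooth_on_differentiable V W (U : set V) (f : V -> W) x :
  smooth_on U f -> U x -> differentiable f x.
Proof. by move=> /(_ 1)[df _]; exact: df. Qed.

Lemma smooth_on_derive V W (U : set V) (f : V -> W) v :
  smooth_on U f -> smooth_on U ('D_v f).
Proof. by move=> sf k; have [_] := sf k.+1; exact. Qed.

Lemma smooth_on_comp V m (U : set V) (U' : set 'rV[R]_m)
    (f : V -> 'rV[R]_m) (g : 'rV[R]_m -> R^o) : open U ->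
  (forall x, U x -> U' (f x)) ->
  smooth_on U f -> smooth_on U' g -> smooth_on U (g \o f).
Proof. by move=> oU fU sf sg k; apply: Ck_on_comp fU _ _. Qed.

Lemma smooth_onD V W (U : set V) (f g : V -> W) : open U ->
  smooth_on U f -> smooth_on U g -> smooth_on U (fun x => f x + g x).
Proof. by move=> oU sf sg k; apply: Ck_onD. Qed.

Lemma smooth_onM V (U : set V) (f g : V -> R^o) : open U ->
  smooth_on U f -> smooth_on U g -> smooth_on U (fun x => f x * g x : R^o).
Proof. by move=> oU sf sg k; apply: Ck_onM. Qed.

Lemma smooth_onN V (U : set V) (f : V -> R^o) : open U ->
  smooth_on U f -> smooth_on U (fun x => - f x : R^o).
Proof.
move=> oU sf k; apply: (@Ck_on_eq _ _ _ _ _ (fun x => -1 * f x : R^o)) => //.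
  by move=> x _; rewrite mulN1r.
by apply: Ck_onM => //; exact: Ck_on_cst.
Qed.

Lemma smooth_onB V (U : set V) (f g : V -> R^o) : open U ->
  smooth_on U f -> smooth_on U g -> smooth_on U (fun x => f x - g x : R^o).
Proof. by move=> oU sf sg; apply: smooth_onD => //; exact: smooth_onN. Qed.

Lemma smooth_on_coord V m n (U : set V) (f : V -> 'M[R]_(m, n)) i j : open U ->
  smooth_on U f -> smooth_on U (fun x => f x i j : R^o).
Proof. by move=> oU sf k; apply: Ck_on_coord. Qed.

Lemma smooth_on_local V W (U : set V) (f : V -> W) :
  (forall x, U x -> exists O : set V, [/\ open O, O x & smooth_on O f]) ->
  smooth_on U f.
Proof.
move=> loc k; elim: k f loc => [|k IH] f loc.
  by move=> x /loc[N [oN Nx /(_ 0)]]; exact.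
split=> [x /loc[N [oN Nx sf]]|v]; first exact: smooth_on_differentiable sf Nx.
apply: IH => x /loc[N [oN Nx sf]]; exists N; split=> //; exact: smooth_on_derive.
Qed.

(** Entrywise, so that only scalar-valued functions have to be differentiated. *)
Definition smooth_mx V m n (U : set V) (F : V -> 'M[R]_(m, n)) :=
  forall i j, smooth_on U (fun x => F x i j : R^o).

Section Mx.
Variables (V : normedModType R) (U : set V).
Hypothesis oU : open U.

Lemma smooth_mxT m n (F : V -> 'M[R]_(m, n)) :
  smooth_mx U F -> smooth_mx U (fun x => (F x)^T).
Proof.
by move=> sF i j; apply: smooth_on_eq (sF j i) => // x _; rewrite mxE.
Qed.

Lemma smooth_mxD m n (F G : V -> 'M[R]_(m, n)) :
  smooth_mx U F -> smooth_mx U G -> smooth_mx U (fun x => F x + G x).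
Proof.
move=> sF sG i j k; under eq_fun do rewrite mxE.
by apply: Ck_onD => //; [exact: sF|exact: sG].
Qed.

Lemma smooth_mxM m n p (F : V -> 'M[R]_(m, n)) (G : V -> 'M[R]_(n, p)) :
  smooth_mx U F -> smooth_mx U G -> smooth_mx U (fun x => F x *m G x).
Proof.
move=> sF sG i j k; under eq_fun do rewrite mxE.
by apply: Ck_on_sum => // l _; apply: Ck_onM => //; [exact: sF|exact: sG].
Qed.

Lemma smooth_on_prod (I : Type) (r : seq I) (P : pred I)
    (f : I -> V -> R^o) :
  (forall i, P i -> smooth_on U (f i)) ->
  smooth_on U (fun x => \prod_(i <- r | P i) f i x : R^o).
Proof.
move=> Cf k; elim: r => [|i r IH].
  by under eq_fun do rewrite big_nil; exact: Ck_on_cst.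
under eq_fun do rewrite big_cons.
case Pi: (P i) => //; apply: Ck_onM => //; exact: Cf.
Qed.

Lemma smooth_mx_det n (F : V -> 'M[R]_n) :
  smooth_mx U F -> smooth_on U (fun x => \det (F x) : R^o).
Proof.
move=> sF k; apply: Ck_on_sum => // s _; apply: Ck_onM => //; first exact: Ck_on_cst.
by apply: smooth_on_prod => i _; exact: sF.
Qed.

(** Cramer's rule expresses the entries of the inverse as quotients of
    determinants. *)
Lemma smooth_mxV n (F : V -> 'M[R]_n) : (forall x, U x -> F x \in unitmx) ->
  smooth_mx U F -> smooth_mx U (fun x => invmx (F x)).
Proof.
move=> uF sF i j.
apply: (@smooth_on_eq _ _ _
    (fun x => (\det (F x))^-1 * ((-1) ^+ (j + i) * \det (row' j (col' i (F x)))))) => //.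
  by move=> x Ux; rewrite /invmx uF// !mxE.
move=> k; apply: Ck_onM => //.
  apply: Ck_on_inv => //; last exact: smooth_mx_det.
  by move=> x Ux; have := uF _ Ux; rewrite unitmxE unitfE.
apply: Ck_onM => //; first exact: Ck_on_cst.
apply: smooth_mx_det => a b; under eq_fun do rewrite !mxE; exact: sF.
Qed.

End Mx.
End Smooth.

(** * Symmetry of second derivatives *)

Section Schwarz.
Context {R : realType}.
Implicit Types V : normedModType R.

Lemma is_diff_line V (y u : V) (s : R) :
  is_diff s (fun t : R^o => y + t *: u) ( *:%R ^~ u).
Proof.
have := @is_diffD _ _ _ _ _ _ _ s (is_diff_cst y s) (is_diff_scalel s u).
by rewrite add0r.
Qed.

Lemma is_diff_shift V (c z : V) : is_diff z (fun y : V => y + c) id.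
Proof.
have := @is_diffD _ _ _ _ _ _ _ z (is_diff_id z) (is_diff_cst c z).
by rewrite addr0.
Qed.

Lemma derive_translate V (f : V -> R^o) (c z u : V) : differentiable f (z + c) ->
  differentiable (fun y => f (y + c)) z /\
  'D_u (fun y => f (y + c)) z = 'D_u f (z + c).
Proof.
move=> df; have [ds es] := is_diff_shift c z.
have dfs : differentiable (f \o (fun y : V => y + c)) z.
  exact: differentiable_comp.
split=> //; rewrite [LHS]deriveE// deriveE//.
by rewrite [LHS](_ : _ = 'd (f \o (fun y : V => y + c)) z u)// diff_comp//= es.
Qed.

Lemma MVT_line V (f : V -> R^o) (y u : V) (h : R) : 0 < h ->
  (forall t, 0 <= t <= h -> differentiable f (y + t *: u)) ->
  exists2 t, 0 <= t <= h & f (y + h *: u) - f y = 'D_u f (y + t *: u) * h.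
Proof.
move=> h0 df; pose l (t : R^o) := y + t *: u.
have dfl t : 0 <= t <= h -> is_derive t 1 (f \o l) ('D_u f (l t)).
  move=> th; have [dl el] := is_diff_line y u t.
  have dfl : differentiable (f \o l) t by apply: differentiable_comp => //; exact: df.
  split; first exact: diff_derivable.
  by rewrite deriveE// diff_comp//; [rewrite /= el scale1r deriveE//; exact: df|exact: df].
have [||t th] := @MVT_segment R (f \o l) (fun t => 'D_u f (l t)) 0 h (ltW h0).
- by move=> t; rewrite in_itv/= => /andP[t0 th]; apply: dfl; rewrite !ltW.
- apply: continuous_in_subspaceT => t; rewrite inE/= in_itv/= => th.
  by apply: differentiable_continuous; apply/derivable1_diffP; have [] := dfl t th.
rewrite subr0 /= /l scale0r addr0 => E; exists t => //.
Qed.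

(** Second-order mean value theorem on a parallelogram; the left-hand side is
    symmetric in [u] and [v], which is what makes mixed derivatives agree. *)
Lemma MVT_parallelogram V (U : set V) (f : V -> R^o) (x u v : V) (h : R) :
  0 < h -> Ck_on 2 U f ->
  (forall s t, 0 <= s <= h -> 0 <= t <= h -> U (x + s *: u + t *: v)) ->
  exists s t, [/\ 0 <= s <= h, 0 <= t <= h &
    f (x + h *: u + h *: v) - f (x + h *: u) - f (x + h *: v) + f x =
    'D_v ('D_u f) (x + s *: u + t *: v) * h * h].
Proof.
move=> h0 [df Df] Upar; pose F z := f (z + h *: v) - f z : R^o.
have hh : 0 <= h <= h by rewrite lexx ltW.
have zh : 0 <= (0:R) <= h by rewrite lexx ltW.
have U0 s : 0 <= s <= h -> U (x + s *: u).
  by move=> sh; have := Upar s 0 sh zh; rewrite scale0r addr0.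
have dF s : 0 <= s <= h -> differentiable F (x + s *: u) /\
    'D_u F (x + s *: u) = 'D_u f (x + s *: u + h *: v) - 'D_u f (x + s *: u).
  move=> sh; have df1 := df _ (U0 _ sh).
  have [dS eS] := derive_translate u (df _ (Upar s h sh hh)).
  split; first exact: differentiableB.
  by rewrite -eS deriveB//; exact: diff_derivable.
have [s sh Fs] := MVT_line h0 (fun s sh => (dF s sh).1).
have [dDf _] := Df u.
have [t th Ft] := MVT_line h0 (fun t th => dDf _ (Upar s t sh th)).
exists s, t; split=> //; rewrite -Ft -(dF s sh).2 -Fs /F.
by rewrite opprB addrA [RHS]addrAC.
Qed.

(** By [MVT_parallelogram] applied to [(u, v)] and to [(v, u)], both mixed
    derivatives take a common value on every small parallelogram at [x]; they
    are continuous at [x], hence equal there. *)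
Lemma schwarz V (U : set V) (f : V -> R^o) (x u v : V) :
  open U -> U x -> Ck_on 2 U f -> 'D_u ('D_v f) x = 'D_v ('D_u f) x.
Proof.
move=> oU Ux Cf; have [_ Df] := Ck_onS Cf.
have cuv := (Ck_onS (Df v)).2 u x Ux.
have cvu := (Ck_onS (Df u)).2 v x Ux.
apply/eqP; rewrite -subr_eq0 -normr_le0; apply/ler_addgt0Pr => e e0.
have e2 : 0 < e / 2 by lra.
have n1 : \forall y \near x, `|'D_u ('D_v f) x - 'D_u ('D_v f) y| < e / 2.
  exact: ((@cvgrPdist_lt _ _ _ _ (nbhs_filter x) _ _).1 cuv _ e2).
have n2 : \forall y \near x, `|'D_v ('D_u f) x - 'D_v ('D_u f) y| < e / 2.
  exact: ((@cvgrPdist_lt _ _ _ _ (nbhs_filter x) _ _).1 cvu _ e2).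
have n3 : \forall y \near x, U y /\ (`|'D_u ('D_v f) x - 'D_u ('D_v f) y| < e / 2
    /\ `|'D_v ('D_u f) x - 'D_v ('D_u f) y| < e / 2).
  by apply: filterS3 (open_near oU Ux) n1 n2 => y.
have /nbhs_ballP[r r0 br] := n3.
pose K := `|u| + `|v| + 1.
have K0 : 0 < K by rewrite /K; have := normr_ge0 u; have := normr_ge0 v; lra.
(* A parallelogram with sides [h *: u] and [h *: v] stays in the ball of radius
   [r] as soon as [h * (|u| + |v|) < r]; the 1 in [K] keeps [K] positive. *)
pose h := r / (2 * K).
have h0 : 0 < h by rewrite divr_gt0// mulr_gt0.
have hr : h * K < r.
  by rewrite /h invfM mulrA divfK ?gt_eqF//; move: r0 => /=; lra.
have par a b s t : `|a| + `|b| + 1 = K -> 0 <= s <= h -> 0 <= t <= h ->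
    ball x r (x + s *: a + t *: b).
  move=> EK /andP[s0 sh] /andP[t0 th]; rewrite -ball_normE/= -addrA opprD addNKr normrN.
  apply: le_lt_trans hr; rewrite -EK.
  apply: le_trans (ler_normD _ _) _; rewrite !normrZ !ger0_norm//.
  have := normr_ge0 a; have := normr_ge0 b => a0 b0.
  rewrite mulrDr mulr1 mulrDr -[leLHS]addr0 lerD//; last exact: ltW.
  by rewrite lerD// ler_wpM2r.
have Kuv : `|v| + `|u| + 1 = K by rewrite /K [`|v| + _]addrC.
have parU s t sh th := (br _ (par u v s t erefl sh th)).1.
have parU' s t sh th := (br _ (par v u s t Kuv sh th)).1.
have [s [t [sh th E1]]] := MVT_parallelogram h0 Cf parU.
have [s' [t' [sh' th' E2]]] := MVT_parallelogram h0 Cf parU'.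
have E : 'D_v ('D_u f) (x + s *: u + t *: v) = 'D_u ('D_v f) (x + s' *: v + t' *: u).
  apply: (mulIf (lt0r_neq0 h0)); apply: (mulIf (lt0r_neq0 h0)).
  apply: etrans (esym E1) (etrans _ E2).
  by rewrite [x + h *: v + h *: u]addrAC; congr (_ + _); exact: addrAC.
have [_ [_ b1]] := br _ (par u v s t erefl sh th).
have [_ [b2 _]] := br _ (par v u s' t' Kuv sh' th').
rewrite E in b1; rewrite add0r (splitr e).
apply: le_trans (ler_distD _ _ _) _; apply: ltW.
by apply: ltrD; [exact: b2|rewrite distrC; exact: b1].
Qed.

End Schwarz.

(** * Exterior algebra and the contact condition *)

Section LinearForm.
Context {R : realType} {E : lmodType R} (phi : E -> R).
Hypothesis phiP : forall c u w, phi (c *: u + w) = c * phi u + phi w.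

Lemma linear_form0 : phi 0 = 0.
Proof.
have := phiP 1 0 0; rewrite scaler0 addr0 mul1r => /eqP.
by rewrite eq_sym -subr_eq0 addrK => /eqP.
Qed.

Lemma linear_formZ c u : phi (c *: u) = c * phi u.
Proof. by rewrite -[c *: u]addr0 phiP linear_form0 addr0. Qed.

Lemma linear_form2 c d u w : phi (c *: u + d *: w) = c * phi u + d * phi w.
Proof. by rewrite phiP linear_formZ. Qed.

Lemma linear_form_sum (I : finType) (c : I -> R) (u : I -> E) :
  phi (\sum_i c i *: u i) = \sum_i c i * phi (u i).
Proof. by elim/big_rec2: _ => [|i x y _ <-]; [exact: linear_form0|exact: phiP]. Qed.

End LinearForm.

Section Alternating.
Context {R : realType} {V : lmodType R}.

Definition multilinear p (a : pform (R := R) (V := V) p) :=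
  forall v i c u w, a [eta v with i |-> c *: u + w] =
    c * a [eta v with i |-> u] + a [eta v with i |-> w].

Definition alternating p (a : pform (R := R) (V := V) p) :=
  forall v i j, i != j -> v i = v j -> a v = 0.

(** For a multilinear [a], [z] is in the kernel of the contraction of [a] in each
    of its slots. *)
Definition null_vector p (a : pform (R := R) (V := V) p) (z : V) :=
  forall v i, v i = z -> a v = 0.

(** Reindexing the sum over permutations by a transposition of two slots that
    hold the same vector changes its sign. *)
Lemma wedge_alternating p q (a : pform p) (b : pform q) :
  alternating (wedge a b : pform (R := R) (V := V) _).
Proof.
move=> v i j ij vij; rewrite /wedge.
set S := \sum_s _; suff : S = - S.
  by move=> /eqP; rewrite -addr_eq0 -mulr2n mulrn_eq0/= => /eqP ->; rewrite mulr0.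
rewrite {1}/S (reindex_inj (@mulIg _ (tperm i j)))/= -sumrN.
apply: eq_bigr => s _; rewrite odd_permM odd_tperm ij addbT signrN mulNr.
by congr (- (_ * (a _ * b _))); apply/funext => l; rewrite permM;
  case: tpermP => // ->.
Qed.

Lemma wedge_null_vector p q (a : pform p) (b : pform q) z :
  null_vector a z -> null_vector b z ->
  null_vector (wedge a b : pform (R := R) (V := V) _) z.
Proof.
move=> na nb v i vi; rewrite /wedge big1 ?mulr0// => s _.
case: (split_ordP ((s^-1)%g i)) => j ej.
  by rewrite (na _ j) ?mul0r ?mulr0// -ej permKV.
by rewrite (nb _ j) ?mulr0// -ej permKV.
Qed.

(** In the term of index [s], slot [i] of the wedge product is slot [s^-1 i] of
    exactly one of the two factors, and the other factor does not depend on it. *)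
Lemma wedge_multilinear p q (a : pform p) (b : pform q) :
  multilinear a -> multilinear b ->
  multilinear (wedge a b : pform (R := R) (V := V) _).
Proof.
move=> ma mb v i c u w; rewrite /wedge [c * _]mulrCA -mulrDr; congr (_ * _).
rewrite big_distrr/= -big_split/=; apply: eq_bigr => s _.
rewrite [c * _]mulrCA -mulrDr; congr (_ * _).
case: (split_ordP ((s^-1)%g i)) => j ej.
  have es : s (lshift q j) = i by rewrite -ej permKV.
  have ea x : (fun k => [eta v with i |-> x] (s (lshift q k))) =
              [eta (fun k => v (s (lshift q k))) with j |-> x].
    apply/funext => k /=; rewrite -es (inj_eq perm_inj) (inj_eq (@lshift_inj _ _))//.
  have eb x : (fun k => [eta v with i |-> x] (s (rshift p k))) =
              (fun k => v (s (rshift p k))).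
    by apply/funext => k /=; rewrite -es (inj_eq perm_inj) eq_rlshift.
  by rewrite !ea !eb ma mulrDl mulrA.
have es : s (rshift p j) = i by rewrite -ej permKV.
have ea x : (fun k => [eta v with i |-> x] (s (rshift p k))) =
            [eta (fun k => v (s (rshift p k))) with j |-> x].
  apply/funext => k /=; rewrite -es (inj_eq perm_inj) (inj_eq (@rshift_inj _ _))//.
have eb x : (fun k => [eta v with i |-> x] (s (lshift q k))) =
            (fun k => v (s (lshift q k))).
  by apply/funext => k /=; rewrite -es (inj_eq perm_inj) eq_lrshift.
by rewrite !ea !eb mb mulrDr mulrCA.
Qed.

Lemma wedge_pow_multilinear (w : pform 2) n :
  multilinear w -> multilinear (wedge_pow w n : pform (R := R) (V := V) _).
Proof.
move=> mw; elim: n => [|n IH]; first by move=> v [].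
exact: wedge_multilinear.
Qed.

Lemma wedge_pow_null_vector (w : pform 2) n z :
  null_vector w z -> null_vector (wedge_pow w n : pform (R := R) (V := V) _) z.
Proof.
move=> mw; elim: n => [|n IH]; first by move=> v [].
exact: wedge_null_vector.
Qed.

Lemma multilinear_sum p (a : pform p) v i (I : finType) (c : I -> R) (u : I -> V) :
  multilinear a ->
  a [eta v with i |-> \sum_j c j *: u j] =
  \sum_j c j * a [eta v with i |-> u j].
Proof.
move=> ma; apply: (@linear_form_sum _ _ (fun x => a [eta v with i |-> x])) => b x y.
exact: ma.
Qed.

End Alternating.

Section TopForm.
Context {R : realType}.

(** A top-degree form with a nonzero null vector vanishes: some nontrivial
    combination of the arguments is either 0 or that null vector, and putting
    it in the place of one of the arguments multiplies the value of the form
    by a nonzero coefficient. *)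
Lemma top_form_null_vector m (a : pform (R := R) (V := 'rV[R]_m) m) z :
  multilinear a -> alternating a -> null_vector a z -> z != 0 ->
  forall v, a v = 0.
Proof.
move=> ma aa na z0 v; pose A := \matrix_i v i.
have n0 : null_vector a 0.
  move=> w i wi.
  have -> : w = [eta w with i |-> 0 *: z].
    by apply/funext => j /=; case: eqP => // ->; rewrite scale0r.
  have := multilinear_sum w i (fun _ : 'I_1 => 0 : R) (fun _ => z) ma.
  by rewrite !big_ord1 mul0r.
have [c c0 nc] : exists2 c : 'rV[R]_m, c != 0 & null_vector a (c *m A).
  have [uA|] := boolP (A \in unitmx).
    exists (z *m invmx A); last by rewrite mulmxKV.
    by apply: contra_neq z0 => z0; rewrite -(mulmxKV uA z) z0 mul0mx.
  rewrite unitmxE unitfE negbK => /det0P[c c0 cA]; exists c => //.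
  by rewrite cA.
have [i ci] : exists i, c 0 i != 0.
  apply/existsP; apply: contra_neqT c0 => /existsPn c0.
  by apply/rowP => i; rewrite mxE; apply/eqP; rewrite -[_ == _]negbK c0.
apply: (mulfI ci); rewrite mulr0.
have := nc [eta v with i |-> c *m A] i; rewrite /= eqxx => /(_ erefl) <-.
rewrite mulmx_sum_row multilinear_sum// (bigD1 i)//= big1 ?addr0.
  congr (_ * a _); apply/funext => j /=.
  by case: eqP => // ->; rewrite rowK.
move=> j ji; rewrite (aa _ i j) ?mulr0//; first by rewrite eq_sym.
by rewrite /= eqxx (negbTE ji) rowK.
Qed.

Lemma skew_odd_det n (M : 'M[R]_(1 + n * 2)) : M^T = - M -> \det M = 0.
Proof.
move=> skM; have := det_tr M; rewrite skM -scaleN1r detZ exprD expr1 exprM.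
rewrite sqrr_sign.
move=> /eqP; rewrite mulr1 mulN1r eq_sym -addr_eq0 -mulr2n mulrn_eq0/=.
by move/eqP.
Qed.

End TopForm.

(** [linfun] applied to a function that is only provably linear. *)
Lemma linfunE (R : realType) (V W : vectType R) (f : V -> W) v :
  linear f -> linfun f v = f v.
Proof.
move=> lf; pose fl : {linear V -> W} := HB.pack f (GRing.isLinear.Build _ _ _ _ f lf).
by rewrite (_ : linfun f = linfun fl)// lfunE.
Qed.

Lemma bilinear_mx (R : realType) m (b : 'rV[R]_m -> 'rV[R]_m -> R) u v :
  (forall c u w v, b (c *: u + w) v = c * b u v + b w v) ->
  (forall c u w v, b v (c *: u + w) = c * b v u + b v w) ->
  b u v = (u *m (\matrix_(i, j) b 'e_i 'e_j) *m v^T) 0 0.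
Proof.
move=> bl br.
have suml c f w : b (\sum_i c i *: f i) w = \sum_(i < m) c i * b (f i) w.
  by apply: (@linear_form_sum _ _ (b ^~ w)) => *; exact: bl.
have sumr c f w : b w (\sum_i c i *: f i) = \sum_(i < m) c i * b w (f i).
  by apply: (@linear_form_sum _ _ (b w)) => *; exact: br.
rewrite {1}[u]row_sum_delta suml mxE.
under [RHS]eq_bigr do rewrite !mxE mulr_suml.
rewrite exchange_big/=; apply: eq_bigr => i _.
rewrite {1}[v]row_sum_delta sumr mulr_sumr; apply: eq_bigr => j _.
by rewrite !mxE mulrCA mulrC.
Qed.

Lemma derive_lincomb (R : realType) (V : normedModType R) (f g : V -> R^o) c x v :
  differentiable f x -> differentiable g x ->
  'D_v (c *: f + g) x = c * 'D_v f x + 'D_v g x.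
Proof.
move=> df dg; rewrite deriveE; last by apply: differentiableD => //; exact: differentiableZ.
rewrite diffD//; last exact: differentiableZ.
by rewrite diffZ// (deriveE _ df) (deriveE _ dg).
Qed.

Section Contact.
Context {R : realType}.

Section Form.
Context {m : nat} (P : smooth_manifold R m) (eta : one_form P).
Hypothesis smooth_eta : smooth_form eta.

Lemma form_in_chart_linear x z c u w :
  form_in_chart eta x (c *: u + w) z =
  c * form_in_chart eta x u z + form_in_chart eta x w z.
Proof. by rewrite /form_in_chart !linearP. Qed.

Lemma chart_cod_at x : chart_cod (chart_at x) (chart_map (chart_at x) (x : P)).
Proof. by have [] := chart_mapK (mem_chart_at x). Qed.

Lemma form_in_chart_differentiable x v z : chart_cod (chart_at x) z ->
  differentiable (form_in_chart eta x v) z.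
Proof. exact: smooth_on_differentiable (smooth_eta x v). Qed.

(** The exterior derivative at an arbitrary point of the chart selected at [x],
    where [dform] looks at the centre only. *)
Definition dform_in_chart x (z u v : 'rV[R]_m) : R :=
  'D_u (form_in_chart eta x v) z - 'D_v (form_in_chart eta x u) z.

Lemma dform_in_chart_skew x z u v :
  dform_in_chart x z u v = - dform_in_chart x z v u.
Proof. by rewrite /dform_in_chart opprB. Qed.

Lemma dform_in_chart_linear x z c u w v : chart_cod (chart_at x) z ->
  dform_in_chart x z (c *: u + w) v =
  c * dform_in_chart x z u v + dform_in_chart x z w v.
Proof.
move=> cz; have df v' := form_in_chart_differentiable v' cz.
have lu : 'D_(c *: u + w) (form_in_chart eta x v) z =
    c * 'D_u (form_in_chart eta x v) z + 'D_w (form_in_chart eta x v) z.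
  by rewrite !deriveE// linearP.
have lv : 'D_v (form_in_chart eta x (c *: u + w)) z =
    c * 'D_v (form_in_chart eta x u) z + 'D_v (form_in_chart eta x w) z.
  have -> : form_in_chart eta x (c *: u + w) =
      c *: form_in_chart eta x u + form_in_chart eta x w.
    by apply/funext => z'; rewrite form_in_chart_linear.
  exact: derive_lincomb.
apply: etrans (congr2 (fun a b : R => a - b) lu lv) _; rewrite /dform_in_chart.
move: ('D_u _ _) ('D_w _ _) ('D_v _ _) ('D_v _ _) => a b a' b'.
by rewrite opprD mulrBr addrACA.
Qed.

Lemma dform_in_chart_linearr x z c u w v : chart_cod (chart_at x) z ->
  dform_in_chart x z v (c *: u + w) =
  c * dform_in_chart x z v u + dform_in_chart x z v w.
Proof.
by move=> cz; rewrite !(dform_in_chart_skew x z v) dform_in_chart_linear// opprD mulrN.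
Qed.

Lemma dform_skew x u v : dform eta x u v = - dform eta x v u.
Proof. exact: dform_in_chart_skew. Qed.

Lemma dform_linear x c u w v :
  dform eta x (c *: u + w) v = c * dform eta x u v + dform eta x w v.
Proof. exact: dform_in_chart_linear (chart_cod_at x). Qed.

Lemma dform_linearr x c u w v :
  dform eta x v (c *: u + w) = c * dform eta x v u + dform eta x v w.
Proof. by rewrite !(dform_skew _ v) dform_linear opprD mulrN. Qed.

End Form.

Section Reeb.
Context {n : nat} (P : contact_manifold R n).
Local Notation V := 'rV[R]_(1 + n * 2).
Local Notation eta := (contact_form P).

(** Such a [z] would be a null vector of [eta /\ (d eta)^n], a top-degree form
    that is not identically zero. *)
Lemma contact_nondegenerate (x : P) (z : V) :
  eta x z = 0 -> (forall w, dform eta x z w = 0) -> z = 0.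
Proof.
move=> ez dz; apply/eqP/negPn/negP => z0.
have [v] := contact_form_contact x; apply/negP/negPn/eqP.
have smooth_eta := @contact_form_smooth _ _ P.
apply: (top_form_null_vector (z := z)) => //.
- apply: wedge_multilinear.
    by move=> w i c u u'; rewrite (ord1 i)/= linearP.
  apply: wedge_pow_multilinear => w i c u u' /=.
  have [->|] := eqVneq i ord0; first by rewrite dform_linear.
  by case: i => [[|[|//]] i2]// _; rewrite dform_linearr.
- exact: wedge_alternating.
- apply: wedge_null_vector.
    by move=> w i; rewrite (ord1 i) => ->.
  apply: wedge_pow_null_vector => w i.
  have [->->|i0] := eqVneq i ord0; first by rewrite dz.
  have -> : i = ord_max by apply/val_inj; case: i i0 => [[|[|//]] i2].
  by move=> ->; rewrite dform_skew dz oppr0.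
Qed.

Lemma dform_mx x (u v : V) :
  dform eta x u v = (u *m (\matrix_(i, j) dform eta x 'e_i 'e_j) *m v^T) 0 0.
Proof.
have smooth_eta := @contact_form_smooth _ _ P.
by apply: bilinear_mx => *; rewrite ?dform_linear// ?dform_linearr.
Qed.

(** A skew form on an odd-dimensional space is degenerate, and nondegeneracy of
    the contact form forces [eta] to be nonzero on its kernel. *)
Lemma reeb_spec x : (forall w, dform eta x (reeb x) w = 0) /\ eta x (reeb x) = 1.
Proof.
apply: (@xgetPex _ 0 [set v | (forall w, dform eta x v w = 0) /\ eta x v = 1]).
pose M : 'M[R]_(1 + n * 2) := \matrix_(i, j) dform eta x 'e_i 'e_j.
have /eqP/det0P[c c0 cM] : \det M = 0.
  by apply: skew_odd_det; apply/matrixP => i j; rewrite !mxE dform_skew.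
have dc w : dform eta x c w = 0 by rewrite dform_mx cM mul0mx mxE.
have ec : eta x c != 0 by apply: contra_neq c0 => /contact_nondegenerate; exact.
exists ((eta x c)^-1 *: c); split => [w|]; last by rewrite linearZ; exact: mulVf.
by rewrite dform_mx -scalemxAl cM scaler0 mul0mx mxE.
Qed.

End Reeb.
End Contact.

(** * Changes of charts *)

Lemma diff_comp_near (R : realType) (U V W : normedModType R)
    (f : U -> V) (g : V -> W) (h : U -> W) (a u : U) :
  (\near a, g (f a) = h a) -> differentiable f a -> differentiable g (f a) ->
  'd h a u = 'd g (f a) ('d f a u).
Proof.
move=> gfh df dg; have dgf : differentiable (g \o f) a by exact: differentiable_comp.
by rewrite -(near_eq_diff gfh dgf) diff_comp.
Qed.

Section ChartChange.
Context {R : realType} {m : nat} {P : smooth_manifold R m}.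
Local Notation phi x := (chart_map (chart_at (x : P))).
Local Notation psi x := (chart_inv (chart_at (x : P))).
Local Notation dom x := (chart_dom (chart_at (x : P))).
Local Notation cod x := (chart_cod (chart_at (x : P))).

Lemma chart_cod_map x q : dom x q -> cod x (phi x q).
Proof. by move=> /chart_mapK[]. Qed.

Lemma chart_mapKE x q : dom x q -> psi x (phi x q) = q.
Proof. by move=> /chart_mapK[]. Qed.

Lemma open_chart_preimage x (N : set P) :
  open N -> open (cod x `&` psi x @^-1` N).
Proof.
move=> oN; rewrite openE => z [cz Nz]; rewrite /interior.
apply: filterI; first by apply: open_nbhs_nbhs; split=> //; exact: chart_cod_open.
by apply: (chart_inv_cts cz); apply: open_nbhs_nbhs.
Qed.

Lemma chart_preimage_near x q (N : set P) : open N -> dom x q -> N q ->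
  \forall w \near phi x q, cod x w /\ N (psi x w).
Proof.
move=> oN dq Nq; apply: (@open_near _ (cod x `&` psi x @^-1` N)).
  exact: open_chart_preimage.
by split; [exact: chart_cod_map|rewrite /= chart_mapKE].
Qed.

Lemma transition_differentiable x y q : dom x q -> dom y q ->
  differentiable (phi y \o psi x) (phi x q).
Proof.
move=> dx dy; apply: smooth_on_differentiable (chart_compat x y) _.
by split; [exact: chart_cod_map|rewrite /= chart_mapKE].
Qed.

Lemma tchangeE x y q v :
  tchange x y q v = 'd (phi y \o psi x) (phi x q) v.
Proof. exact: lfunE. Qed.

Lemma mdfE (f : P -> R^o) x v : mdf f x v = 'd (f \o psi x) (phi x x) v.
Proof. exact: lfunE. Qed.

(** The chain rule: the transition maps compose as expected near [phi x q], where
    the three charts overlap. *)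
Lemma tchange_comp x y z q v : dom x q -> dom y q -> dom z q ->
  tchange y z q (tchange x y q v) = tchange x z q v.
Proof.
move=> dx dy dz.
apply: etrans (tchangeE _ _ _ _) (etrans (congr1 _ (tchangeE _ _ _ _)) _).
apply: etrans (esym (tchangeE _ _ _ _)).
rewrite [RHS](@diff_comp_near _ _ _ _ (phi y \o psi x) (phi z \o psi y)).
- by rewrite /= chart_mapKE.
- have := chart_preimage_near (chart_dom_open (chart_at y)) dx dy.
  by apply: filterS => w [_ dw] /=; rewrite chart_mapKE.
- exact: transition_differentiable.
- by rewrite /= chart_mapKE//; exact: transition_differentiable.
Qed.

Lemma tchange_id x q v : dom x q -> tchange x x q v = v.
Proof.
move=> dx; rewrite tchangeE.
have nid : {near phi x q, id =1 phi x \o psi x}.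
  apply: filterS (open_near (@chart_cod_open _ _ _ _) (chart_cod_map dx)) => w cw.
  by have [_ /= ->] := chart_invK cw.
by rewrite -(near_eq_diff nid)// diff_val.
Qed.

Lemma tchangeK x y q v : dom x q -> dom y q -> tchange y x q (tchange x y q v) = v.
Proof. by move=> dx dy; rewrite tchange_comp// tchange_id. Qed.

(** By compatibility of the charts, smoothness near a point may be tested in the
    chart selected at that very point. *)
Lemma smooth_near_centres (f : P -> R^o) :
  (forall x, exists N : set 'rV[R]_m,
     [/\ open N, N (phi x x) & smooth_on N (f \o psi x)]) -> Cinf f.
Proof.
move=> loc x; apply: smooth_on_local => z [cz _].
pose q := psi x z; have [N [oN Nq sf]] := loc q.
have [dxq zq] := chart_invK cz; rewrite -/q in dxq zq.
pose T := cod x `&` psi x @^-1` (dom q).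
have oT : open T by apply: open_chart_preimage; exact: chart_dom_open.
have Tz : T z by split => //; exact: mem_chart_at.
have sT : smooth_on T (phi q \o psi x) by exact: chart_compat.
have nN : \near z, N ((phi q \o psi x) z).
  have c := differentiable_continuous (smooth_on_differentiable sT Tz).
  exact: c _ (open_near oN Nq).
pose O := T `&` [set w | N ((phi q \o psi x) w)]°.
have oO : open O by apply: openI => //; exact: open_interior.
have sO : smooth_on O ((f \o psi q) \o (phi q \o psi x)).
  apply: (@smooth_on_comp _ _ _ _ N) => //; last by apply: smooth_on_sub sT => w [].
  by move=> w [_ /interior_subset].
exists O; split=> //.
apply: smooth_on_eq sO => // w [[cw dw] _] /=; rewrite chart_mapKE//.
Qed.

Lemma mdf_change (f : P -> R^o) x y v : Cinf f -> dom x y ->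
  mdf f y v = 'd (f \o psi x) (phi x y) (tchange y x y v).
Proof.
move=> sf dy; rewrite mdfE tchangeE.
have dyy := mem_chart_at y.
rewrite [LHS](@diff_comp_near _ _ _ _ (phi x \o psi y) (f \o psi x)).
- by rewrite /= chart_mapKE.
- have := chart_preimage_near (chart_dom_open (chart_at x)) dyy dy.
  by apply: filterS => w [_ dw] /=; rewrite chart_mapKE.
- exact: transition_differentiable.
- rewrite /= chart_mapKE//; apply: smooth_on_differentiable (sf x) _.
  by split=> //; exact: chart_cod_map.
Qed.

Section Form.
Variable eta : one_form P.
Hypothesis smooth_eta : smooth_form eta.

Lemma form_change x p v : dom x p ->
  eta p v = form_in_chart eta x (tchange p x p v) (phi x p).
Proof.
by move=> dp; rewrite /form_in_chart chart_mapKE// tchangeK//; exact: mem_chart_at.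
Qed.

(** Passing from one chart to the other pulls the coordinate expression of a form
    back by the transition map. *)
Lemma form_in_chart_change x y z v : cod y z -> dom x (psi y z) ->
  form_in_chart eta y v z =
  form_in_chart eta x ('D_v (phi x \o psi y) z) ((phi x \o psi y) z).
Proof.
move=> cz dx; have [dq zq] := chart_invK cz.
rewrite /form_in_chart /= chart_mapKE//; set q := psi y z.
have -> : 'D_v (phi x \o psi y) z = tchange y x q v.
  rewrite deriveE; first by rewrite tchangeE zq.
  by rewrite -zq; exact: transition_differentiable.
apply: (congr1 (eta q)); apply: esym; apply: tchange_comp => //.
exact: mem_chart_at.
Qed.

Lemma form_in_chart_sum x z (v : 'rV[R]_m) :
  form_in_chart eta x v z = \sum_j v 0 j * form_in_chart eta x 'e_j z.
Proof.
rewrite {1}[v]row_sum_delta /form_in_chart !linear_sum; apply: eq_bigr => j _.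
by rewrite !linearZ.
Qed.

(** [d eta] is a tensor. Differentiating the pulled back expression of [eta]
    yields the pulled back derivative plus a term in the second derivatives of
    the transition map [f]; the latter is symmetric by [schwarz], and cancels on
    antisymmetrization. *)
Lemma dform_change x p u v : dom x p ->
  dform eta p u v =
  dform_in_chart eta x (phi x p) (tchange p x p u) (tchange p x p v).
Proof.
move=> dp; pose f := phi x \o psi p; pose z := phi p p.
have dpp := mem_chart_at p.
have fz : f z = phi x p by rewrite /f /z /= chart_mapKE.
have ez : phi p p = z by [].
set Z := cod p `&` psi p @^-1` dom x.
have oZ : open Z by apply: open_chart_preimage; exact: chart_dom_open.
have Zz : Z z by split; [exact: chart_cod_map|rewrite /= chart_mapKE].
have sf : smooth_on Z f by exact: chart_compat.
have df : differentiable f z by exact: smooth_on_differentiable sf Zz.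
have Tf w : tchange p x p w = 'D_w f z by rewrite deriveE//; exact: tchangeE.
have dA w : differentiable (form_in_chart eta x w) (f z).
  by rewrite fz; apply: smooth_on_differentiable (smooth_eta x w) _; exact: chart_cod_map.
have D u' v' : 'D_u' (form_in_chart eta p v') z =
    \sum_j 'D_u' ('D_v' f) z 0 j * form_in_chart eta x 'e_j (f z) +
    'D_('D_u' f z) (form_in_chart eta x ('D_v' f z)) (f z).
  rewrite (@near_eq_derive _ _ _ _
      (\sum_j (fun w => 'D_v' f w 0 j * form_in_chart eta x 'e_j (f w))) z); last first.
    apply: filterS (open_near oZ Zz) => w [cw dw].
    by rewrite (@form_in_chart_change x)// form_in_chart_sum fct_sumE.
  have dDf : differentiable ('D_v' f) z.
    exact: smooth_on_differentiable (smooth_on_derive v' sf) Zz.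
  have dc j : differentiable (fun w => 'D_v' f w 0 j : R^o) z.
    by apply: smooth_on_differentiable (smooth_on_coord 0 j oZ (smooth_on_derive v' sf)) Zz.
  have dAf j : differentiable (form_in_chart eta x 'e_j \o f) z.
    exact: differentiable_comp.
  rewrite derive_sum; last first.
    move=> j; apply: derivableM; apply: diff_derivable; first exact: dc.
    exact: dAf.
  have -> : form_in_chart eta x ('D_v' f z) =
      \sum_j 'D_v' f z 0 j *: form_in_chart eta x 'e_j.
    by apply/funext => w; rewrite form_in_chart_sum fct_sumE.
  rewrite derive_sum; last first.
    by move=> j; apply: derivableZ; apply: diff_derivable; exact: dA.
  rewrite -big_split/=; apply: eq_bigr => j _.
  have e1 : 'D_u' (fun w => 'D_v' f w 0 j : R^o) z = 'D_u' ('D_v' f) z 0 j.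
    by rewrite derive_mx ?mxE//; exact: diff_derivable.
  have e2 : 'D_u' (form_in_chart eta x 'e_j \o f) z =
      'D_('D_u' f z) (form_in_chart eta x 'e_j) (f z).
    rewrite [LHS]deriveE; last exact: dAf.
    rewrite [RHS](deriveE _ (dA _)) (deriveE _ df).
    exact: (congr1 (fun h => h u') (diff_comp df (dA 'e_j))).
  have e3 := deriveZ ('D_v' f z 0 j) (diff_derivable (v := 'D_u' f z) (dA 'e_j)).
  apply: etrans (deriveM (diff_derivable (dc j)) (diff_derivable (dAf j))) _.
  apply: etrans (congr2 (fun a b : R => 'D_v' f z 0 j * a +
    form_in_chart eta x 'e_j (f z) * b) e2 e1) _.
  apply: etrans (congr1 (fun a : R => _ + a) (esym e3)).
  by rewrite addrC [X in X + _]mulrC.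
rewrite /dform ez !D /dform_in_chart -fz !Tf.
have S j : 'D_u ('D_v f) z 0 j = 'D_v ('D_u f) z 0 j.
  have c u' v' : 'D_u' ('D_v' f) z 0 j = 'D_u' ('D_v' (fun w => f w 0 j : R^o)) z.
    have dDf : differentiable ('D_v' f) z.
      exact: smooth_on_differentiable (smooth_on_derive v' sf) Zz.
    have -> : 'D_u' ('D_v' f) z 0 j = 'D_u' (fun w => 'D_v' f w 0 j : R^o) z.
      by rewrite derive_mx ?mxE//; exact: diff_derivable.
    apply: near_eq_derive; apply: filterS (open_near oZ Zz) => w Zw.
    rewrite derive_mx ?mxE//; apply: diff_derivable.
    exact: smooth_on_differentiable sf Zw.
  apply: etrans (c _ _) (etrans _ (esym (c _ _))).
  exact: schwarz oZ Zz (smooth_on_coord 0 j oZ sf 2%N).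
have ES : \sum_j 'D_u ('D_v f) z 0 j * form_in_chart eta x 'e_j (f z) =
    \sum_j 'D_v ('D_u f) z 0 j * form_in_chart eta x 'e_j (f z).
  by apply: eq_bigr => j _; apply: (congr1 ( *%R^~ _)); exact: S.
have sub_eq (a b y y' : R) : a = b -> a + y - (b + y') = y - y'.
  by move=> ->; rewrite opprD addrACA subrr add0r.
exact: sub_eq.
Qed.

End Form.
End ChartChange.

Section MapChange.
Context {R : realType} {m k : nat} {M : smooth_manifold R k} {P : smooth_manifold R m}.

Lemma mdiffE (i : M -> P) (x : M) v : mdiff i x v =
  'd (chart_map (chart_at (i x)) \o i \o chart_inv (chart_at x))
     (chart_map (chart_at x) x) v.
Proof. exact: lfunE. Qed.

(** Both sides are the differential at [y] of the expression of [i] in the chart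
    selected at [y] and the chart selected at [i x], factored in two ways. *)
Lemma mdiff_change (i : M -> P) (x y : M) v : smooth_map i ->
  chart_dom (chart_at x) y -> chart_dom (chart_at (i x)) (i y) ->
  tchange (i y) (i x) (i y) (mdiff i y v) =
  'd (chart_map (chart_at (i x)) \o i \o chart_inv (chart_at x))
     (chart_map (chart_at x) y) (tchange y x y v).
Proof.
move=> [ci si] dy diy; rewrite [LHS]tchangeE mdiffE [X in _ = 'd _ _ X]tchangeE.
have dyy := mem_chart_at y; have diyy := mem_chart_at (i y).
have di a b : chart_dom (chart_at a) b -> chart_dom (chart_at (i a)) (i b) ->
    differentiable (chart_map (chart_at (i a)) \o i \o chart_inv (chart_at a))
      (chart_map (chart_at a) b).
  move=> da dia; apply: smooth_on_differentiable (si a) _.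
  by split; [exact: chart_cod_map|rewrite /= chart_mapKE].
have opre (N : set P) : open N -> open (i @^-1` N).
  by move: N; apply/continuousP.
set h := chart_map (chart_at (i x)) \o i \o chart_inv (chart_at y).
have ey : chart_inv (chart_at y) (chart_map (chart_at y) y) = y by exact: chart_mapKE.
transitivity ('d h (chart_map (chart_at y) y) v).
  rewrite [RHS](@diff_comp_near _ _ _ _
    (chart_map (chart_at (i y)) \o i \o chart_inv (chart_at y))
    (chart_map (chart_at (i x)) \o chart_inv (chart_at (i y))) h).
  - by rewrite /= ey.
  - have := chart_preimage_near (opre _ (chart_dom_open (chart_at (i y)))) dyy diyy.
    by apply: filterS => w [_ dw] /=; rewrite /h/= chart_mapKE.
  - exact: di.
  - by rewrite /= ey; exact: transition_differentiable.
rewrite [LHS](@diff_comp_near _ _ _ _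
  (chart_map (chart_at x) \o chart_inv (chart_at y))
  (chart_map (chart_at (i x)) \o i \o chart_inv (chart_at x)) h).
- by rewrite /= ey.
- have := chart_preimage_near (chart_dom_open (chart_at x)) dyy dy.
  by apply: filterS => w [_ dw] /=; rewrite /h/= chart_mapKE.
- exact: transition_differentiable.
- by rewrite /= ey; exact: di.
Qed.

End MapChange.

(** * Matrices of the contact isomorphism and of the projection *)

Lemma daddv_pi0 (K : fieldType) (V : vectType K) (U W : {vspace V}) w :
  (U :&: W)%VS = 0%VS -> w \in W -> daddv_pi U W w = 0.
Proof.
move=> UW wW; have WU : (W :&: U)%VS = 0%VS by rewrite capvC.
have := daddv_pi_add UW (subvP (addvSr U W) _ wW).
by rewrite (daddv_pi_id WU wW) => /eqP; rewrite -subr_eq0 addrK => /eqP.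
Qed.

(** Matrix of the bilinear form [flat] when [B] is that of [d eta] and [A] that
    of [eta]. *)
Definition flat_matrix (R : realType) m (B : 'M[R]_m) (A : 'cV[R]_m) : 'M[R]_m :=
  B + A *m A^T.

(** With the rows of [J] spanning the tangent space and the rows of [F] spanning
    the constraint subspace, [J *m G *m F^T] pairs the one with the other. *)
Definition pairing_matrix (R : realType) m k (G : 'M[R]_m) (J F : 'M[R]_(k, m)) :
  'M[R]_k := J *m G *m F^T.

(** Coordinates of the projection: the row [c] with
    [(v - c *m J) *m G *m F^T = 0] is [v *m cproj_matrix G J F]. *)
Definition cproj_matrix (R : realType) m k (G : 'M[R]_m) (J F : 'M[R]_(k, m)) :
  'M[R]_(m, k) := G *m F^T *m invmx (pairing_matrix G J F).

Section Sharp.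
Context {R : realType} {n : nat} (P : contact_manifold R n).
Local Notation V := 'rV[R]_(1 + n * 2).
Local Notation eta := (contact_form P).

Lemma flatE (x : P) v w :
  flat x v w = dform eta x v w + eta x v * eta x w.
Proof.
have smooth_eta := @contact_form_smooth _ _ P.
have etaP c a b : eta x (c *: a + b) = c * eta x a + eta x b := linearP _ _ _ _.
have lw v' : linear (fun w' => dform eta x v' w' + eta x v' * eta x w' : R^o).
  have gen (c d d' e f f' : R) :
    c * d + d' + e * (c * f + f') = c * (d + e * f) + (d' + e * f') by ring.
  by move=> c a b; rewrite dform_linearr// etaP; exact: gen.
have lv : linear (fun v' =>
    linfun (fun w' => dform eta x v' w' + eta x v' * eta x w' : R^o)).
  have gen (c d d' e f f' : R) :
    c * d + d' + (c * f + f') * e = c * (d + f * e) + (d' + f' * e) by ring.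
  move=> c a b; apply/lfunP => u; rewrite add_lfunE scale_lfunE !linfunE//.
  by rewrite dform_linear// etaP; exact: gen.
by rewrite /flat linfunE// linfunE.
Qed.

(** Evaluating [flat x v = 0] at [v] gives [eta v = 0], then [d eta (v, -) = 0]. *)
Lemma flat_inj (x : P) : lker (flat x) == 0%VS.
Proof.
rewrite -subv0; apply/subvP => v; rewrite memv_ker memv0 => /eqP fv.
have smooth_eta := @contact_form_smooth _ _ P.
have dvv : dform eta x v v = 0.
  by have /eqP := dform_skew eta x v v; rewrite -addr_eq0 -mulr2n mulrn_eq0/= => /eqP.
have fvw w : dform eta x v w + eta x v * eta x w = 0.
  by rewrite -flatE fv zero_lfunE.
have ev : eta x v = 0.
  by have /eqP := fvw v; rewrite dvv add0r mulf_eq0 orbb => /eqP.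
apply/eqP; apply: (contact_nondegenerate ev) => w.
by have := fvw w; rewrite ev mul0r addr0.
Qed.

Lemma flatK (x : P) v : sharp x (flat x v) = v.
Proof. exact: lker0_lfunK (flat_inj x) v. Qed.

(** [T] plays the role of the change of components to a fixed chart; [B] and [A]
    are then the components of [d eta] and [eta] in that chart. *)
Section Frame.
Variables (p : P) (T T' : 'End(V)) (B : 'M[R]_(1 + n * 2)) (A : 'cV[R]_(1 + n * 2)).
Hypotheses (TK : cancel T T') (TK' : cancel T' T).
Hypothesis dformE : forall u v, dform eta p u v = (T u *m B *m (T v)^T) 0 0.
Hypothesis etaE : forall v, eta p v = (T v *m A) 0 0.

Let G := flat_matrix B A.

Lemma flat_mx u v : flat p u v = (T u *m G *m (T v)^T) 0 0.
Proof.
rewrite flatE dformE !etaE /G /flat_matrix mulmxDr mulmxDl [RHS]mxE; congr (_ + _).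
rewrite mulmxA -mulmxA -trmx_mul [RHS]mxE big_ord1; congr (_ * _).
by rewrite [RHS]mxE.
Qed.

Lemma flat_mx_unit : G \in unitmx.
Proof.
rewrite unitmxE unitfE; apply/negP => /det0P[c c0 cG]; move/negP: c0; apply.
have : T' c \in lker (flat p).
  rewrite memv_ker; apply/eqP/lfunP => v.
  by rewrite flat_mx TK' cG mul0mx mxE zero_lfunE.
rewrite (eqP (flat_inj p)) memv0 => /eqP Tc.
by rewrite -(TK' c) Tc linear0.
Qed.

Lemma covector_col (a : 'Hom(V, R^o)) :
  exists al : 'cV[R]_(1 + n * 2), forall v, a v = (T v *m al) 0 0.
Proof.
exists (\col_j a (T' 'e_j)) => v; rewrite -{1}(TK v) {1}[T v]row_sum_delta.
rewrite !linear_sum mxE; apply: eq_bigr => j _.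
by rewrite !linearZ/= [in RHS]mxE.
Qed.

Lemma sharp_mx (a : 'Hom(V, R^o)) al : (forall v, a v = (T v *m al) 0 0) ->
  T (sharp p a) = al^T *m invmx G.
Proof.
move=> aE; pose w := T' (al^T *m invmx G).
have -> : a = flat p w.
  apply/lfunP => v; rewrite aE flat_mx /w TK' mulmxKV ?flat_mx_unit//.
  by rewrite -trmx_mul [RHS]mxE.
by rewrite flatK /w TK'.
Qed.

(** The Reeb vector is [sharp eta], as [flat] sends it to [eta]. *)
Lemma reeb_mx : T (reeb p) = A^T *m invmx G.
Proof.
rewrite -(sharp_mx etaE); congr (T _); rewrite -[LHS](flatK p); congr (sharp p _).
have [dr er] := reeb_spec p.
by apply/lfunP => v; rewrite flatE dr er add0r mul1r.
Qed.

Lemma jacobi_mx (a b : 'Hom(V, R^o)) (al be : 'cV[R]_(1 + n * 2)) :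
  (forall v, a v = (T v *m al) 0 0) -> (forall v, b v = (T v *m be) 0 0) ->
  jacobi p a b =
  - ((al^T *m invmx G) *m B *m (be^T *m invmx G)^T) 0 0.
Proof. by move=> aE bE; rewrite /jacobi dformE (sharp_mx aE) (sharp_mx bE). Qed.

End Frame.
End Sharp.

Section Projection.
Context {R : realType} {n k r : nat} (S : constrained_system R n k r).
Local Notation V := 'rV[R]_(1 + n * 2).
Local Notation M := (cs_sub S).
Local Notation eta := (contact_form S).

Variables (y : M) (T T' : 'End(V)) (t t' : 'End('rV[R]_k)).
Variables (B : 'M[R]_(1 + n * 2)) (A : 'cV[R]_(1 + n * 2)).
Variables (J : 'M[R]_(k, 1 + n * 2)) (s : 'I_k -> V).
Hypotheses (TK : cancel T T') (TK' : cancel T' T).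
Hypothesis tK' : cancel t' t.
Hypothesis dformE : forall u v,
  dform eta (incl S y) u v = (T u *m B *m (T v)^T) 0 0.
Hypothesis etaE : forall v, eta (incl S y) v = (T v *m A) 0 0.
Hypothesis mdiffE : forall c, T (mdiff (incl S) y c) = t c *m J.
Hypothesis mdiff_inj : lker (mdiff (incl S) y) = 0%VS.
Hypothesis frame : basis_of (cs_bundle S y) [seq s j | j <- enum 'I_k].
Hypothesis transverse : (perp y :&: tangent_sub y)%VS = 0%VS.

Let G := flat_matrix B A.
Let Sm : 'M[R]_(k, 1 + n * 2) := \matrix_j T (s j).
Let C := pairing_matrix G J Sm.
Let N := cproj_matrix G J Sm.

Lemma frame_annihilator (a : 'Hom(V, R^o)) :
  a \in annihilator (cs_bundle S y) <-> forall j, a (s j) = 0.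
Proof.
have [spanF _] := andP frame.
rewrite annihilatorP; split=> [aF j|as0 v vF].
  apply: aF; rewrite -(eqP spanF); apply: memv_span.
  by apply/mapP; exists j => //; rewrite mem_enum.
have : (cs_bundle S y <= lker a)%VS.
  rewrite -(eqP spanF); apply/span_subvP => _ /mapP[j _ ->].
  by rewrite memv_ker as0.
by move=> /subvP/(_ v vF); rewrite memv_ker => /eqP.
Qed.

(** [u] lies in [sharp] of the annihilator of the constraint subspace iff
    [flat u] vanishes on a frame of it. *)
Lemma mem_perp u : u \in perp y <-> T u *m G *m Sm^T = 0.
Proof.
have rowS w (j : 'I_k) : (w *m Sm^T) 0 j = (w *m (T (s j))^T) 0 0.
  by rewrite !mxE; apply: eq_bigr => i _; rewrite !mxE.
split.
  move=> /memv_imgP[a /frame_annihilator as0 ->].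
  have [al aE] := covector_col TK a.
  rewrite (sharp_mx TK' dformE etaE aE) mulmxKV ?(flat_mx_unit TK' dformE etaE)//.
  apply/rowP => j; rewrite rowS [RHS]mxE -trmx_mul mxE -aE; exact: as0.
move=> uS; rewrite -(flatK (incl S y) u); apply: memv_img.
apply/frame_annihilator => j.
by rewrite (flat_mx dformE etaE) -rowS uS mxE.
Qed.

(** A vector in the left kernel would give a tangent vector lying in [perp y],
    against transversality. The equality of the rank and of the dimension is
    what makes this matrix square. *)
Lemma pairing_unit : C \in unitmx.
Proof.
rewrite unitmxE unitfE; apply/negP => /det0P[c c0 cC]; move/negP: c0; apply.
pose u := mdiff (incl S) y (t' c).
have Tu : T u = c *m J by rewrite mdiffE tK'.
have : u \in (perp y :&: tangent_sub y)%VS.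
  rewrite memv_cap; apply/andP; split; last by apply: memv_img; exact: memvf.
  by apply/mem_perp; rewrite Tu -!mulmxA [J *m _]mulmxA.
rewrite transverse memv0 => u0.
have : t' c \in lker (mdiff (incl S) y) by rewrite memv_ker.
by rewrite mdiff_inj memv0 => /eqP tc; rewrite -(tK' c) tc linear0.
Qed.

(** The row [T v *m N] is chosen so that the tangent vector with these
    components differs from [v] by a member of [perp y]; hence the two subspaces
    span the whole space, and this is the decomposition of [v]. *)
Lemma cproj_mx v : t (cproj y v) = T v *m N.
Proof.
pose c := T v *m N; pose u := mdiff (incl S) y (t' c).
have Tu : T u = c *m J by rewrite mdiffE tK'.
have tp : (tangent_sub y :&: perp y)%VS = 0%VS by rewrite capvC.
have uT : u \in tangent_sub y by apply: memv_img; exact: memvf.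
have vuP : v - u \in perp y.
  apply/mem_perp; rewrite linearB/= Tu /c /N /cproj_matrix !mulmxBl.
  rewrite -!mulmxA [J *m (G *m _)]mulmxA -/(pairing_matrix G J Sm).
  by rewrite mulVmx ?pairing_unit// mulmx1 subrr.
have -> : cproj y v = t' c.
  rewrite /cproj comp_lfunE -{1}(subrK u v) linearD/= daddv_pi0// add0r.
  by rewrite daddv_pi_id// lker0_lfunK// mdiff_inj.
by rewrite tK'.
Qed.

Lemma cproj_covector_mx (a : 'Hom('rV[R]_k, R^o)) (al : 'cV[R]_k) :
  (forall c, a c = (t c *m al) 0 0) ->
  forall v, (a \o cproj y)%VF v = (T v *m (N *m al)) 0 0.
Proof. by move=> aE v; rewrite comp_lfunE aE cproj_mx (mulmxA (T v) N al). Qed.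

(** Every factor on the right-hand side is a component in fixed charts, whence the
    smoothness of the bracket. *)
Lemma nh_bracket_mx (f g : M -> R^o) (df dg : 'cV[R]_k) :
  (forall c, mdf f y c = (t c *m df) 0 0) ->
  (forall c, mdf g y c = (t c *m dg) 0 0) ->
  nh_bracket f g y =
  - (((N *m df)^T *m invmx G) *m B *m ((N *m dg)^T *m invmx G)^T) 0 0
  - f y * (A^T *m invmx G *m N *m dg) 0 0
  + g y * (A^T *m invmx G *m N *m df) 0 0.
Proof.
move=> fE gE; rewrite /nh_bracket /reebHM_der /reebHM /lambdaHM.
rewrite (jacobi_mx TK' dformE etaE (cproj_covector_mx fE) (cproj_covector_mx gE)).
have rE : t (cproj y (reeb (incl S y))) = A^T *m invmx G *m N.
  exact: etrans (cproj_mx _) (congr1 (mulmxr N) (reeb_mx TK' dformE etaE)).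
congr (_ - _ * _ + _ * _); first by rewrite gE rE.
by rewrite fE rE.
Qed.

End Projection.

(** * Algebraic identities of the bracket *)

Section MdfAlgebra.
Context {R : realType} {m : nat} {P : smooth_manifold R m}.
Implicit Types f g : P -> R^o.

Lemma Cinf_differentiable f x : Cinf f ->
  differentiable (f \o chart_inv (chart_at x)) (chart_map (chart_at x) x).
Proof.
move=> sf; apply: smooth_on_differentiable (sf x) _; split=> //.
exact: chart_cod_at.
Qed.

Lemma mdf_derive f x v :
  differentiable (f \o chart_inv (chart_at x)) (chart_map (chart_at x) x) ->
  mdf f x v = 'D_v (f \o chart_inv (chart_at x)) (chart_map (chart_at x) x).
Proof. by move=> df; rewrite (deriveE _ df) mdfE. Qed.

Lemma mdf_lincomb c f g x : Cinf f -> Cinf g ->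
  mdf (c *: f + g) x = c *: mdf f x + mdf g x.
Proof.
move=> /(Cinf_differentiable x) df /(Cinf_differentiable x) dg.
have dfg : differentiable (c *: (f \o chart_inv (chart_at x)) +
    (g \o chart_inv (chart_at x))) (chart_map (chart_at x) x).
  by apply: differentiableD => //; exact: differentiableZ.
apply/lfunP => v; rewrite add_lfunE [X in _ = X + _]scale_lfunE.
apply: etrans (mdf_derive (f := c *: f + g) v dfg) _.
apply: etrans (derive_lincomb _ _ df dg) _.
exact: esym (congr2 (fun a b : R => c * a + b) (mdf_derive v df) (mdf_derive v dg)).
Qed.

Lemma mdf_mul f g x : Cinf f -> Cinf g ->
  mdf (f \* g) x = f x *: mdf g x + g x *: mdf f x.
Proof.
move=> /(Cinf_differentiable x) df /(Cinf_differentiable x) dg.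
apply/lfunP => v; rewrite add_lfunE [X in _ = X + _]scale_lfunE.
rewrite [X in _ = _ + X]scale_lfunE.
have dfg := differentiableM df dg.
apply: etrans (mdf_derive (f := f \* g) v dfg) _.
apply: etrans (deriveM (diff_derivable df) (diff_derivable dg)) _.
apply: etrans (esym (congr2 (fun a b : R => f x * a + g x * b)
  (mdf_derive v dg) (mdf_derive v df))).
by rewrite /= (chart_mapKE (mem_chart_at x)).
Qed.

End MdfAlgebra.

Section BracketAlgebra.
Context {R : realType} {n k r : nat} (S : constrained_system R n k r).
Local Notation M := (cs_sub S).
Implicit Types (f g h : M -> R^o) (x : M) (a b d : 'Hom('rV[R]_k, R^o)).

Lemma lambdaHM_skew x a b : lambdaHM x a b = - lambdaHM x b a.
Proof. by rewrite /lambdaHM /jacobi dform_skew. Qed.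

Lemma lambdaHM_linear x c a b d :
  lambdaHM x (c *: a + b) d = c * lambdaHM x a d + lambdaHM x b d.
Proof.
have smooth_eta := @contact_form_smooth _ _ S.
rewrite /lambdaHM /jacobi comp_lfunDl -comp_lfunZl linearP dform_linear//.
by rewrite opprD mulrN.
Qed.

Lemma lambdaHM_linearr x c a b d :
  lambdaHM x d (c *: a + b) = c * lambdaHM x d a + lambdaHM x d b.
Proof. by rewrite !(lambdaHM_skew x d) lambdaHM_linear opprD [in RHS]mulrN. Qed.

Lemma reebHM_der_lincomb c f g x : Cinf f -> Cinf g ->
  reebHM_der (c *: f + g) x = c * reebHM_der f x + reebHM_der g x.
Proof. by move=> sf sg; rewrite /reebHM_der mdf_lincomb// add_lfunE scale_lfunE. Qed.

Lemma reebHM_der_mul f g x : Cinf f -> Cinf g ->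
  reebHM_der (f \* g) x = f x * reebHM_der g x + g x * reebHM_der f x.
Proof.
move=> sf sg; rewrite /reebHM_der mdf_mul//; apply: etrans (add_lfunE _ _ _) _.
exact: congr2 (scale_lfunE _ _ _) (scale_lfunE _ _ _).
Qed.

Lemma nh_bracket_skew f g : nh_bracket f g = - nh_bracket g f.
Proof.
have skew (l l' a b : R) : l = - l' -> l - a + b = - (l' - b + a).
  by move=> ->; ring.
by apply/funext => x; exact: skew (lambdaHM_skew x _ _).
Qed.

Lemma nh_bracket_lincomb c f g h : Cinf f -> Cinf g -> Cinf h ->
  nh_bracket (c *: f + g) h = c *: nh_bracket f h + nh_bracket g h.
Proof.
have lincomb (l l' rf rg rh fx gx hx : R) :
    c * l + l' - (c * fx + gx) * rh + hx * (c * rf + rg) =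
    c * (l - fx * rh + hx * rf) + (l' - gx * rh + hx * rg) by ring.
move=> sf sg sh; apply/funext => x; rewrite /nh_bracket mdf_lincomb//.
rewrite lambdaHM_linear reebHM_der_lincomb//; exact: lincomb.
Qed.

Lemma nh_bracket_leibniz f g h x : Cinf f -> Cinf g -> Cinf h ->
  nh_bracket f (g \* h) x =
  g x * nh_bracket f h x + h x * nh_bracket f g x - g x * h x * reebHM_der f x.
Proof.
have leibniz (l l' rf rg rh fx gx hx : R) :
    gx * l + hx * l' - fx * (gx * rh + hx * rg) + gx * hx * rf =
    gx * (l - fx * rh + hx * rf) + hx * (l' - fx * rg + gx * rf)
    - gx * hx * rf by ring.
move=> sf sg sh; rewrite /nh_bracket mdf_mul// reebHM_der_mul//.
have -> : lambdaHM x (mdf f x) (g x *: mdf h x + h x *: mdf g x) =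
    g x * lambdaHM x (mdf f x) (mdf h x) + h x * lambdaHM x (mdf f x) (mdf g x).
  by apply: linear_form2 => c a b; exact: lambdaHM_linearr.
exact: leibniz.
Qed.

End BracketAlgebra.

(** * Smoothness of the bracket *)

Lemma smooth_on_of_mx (R : realType) (V : normedModType R) (U : set V)
    (F : V -> 'M[R]_1) : smooth_mx U F -> smooth_on U (fun x => F x 0 0 : R^o).
Proof. exact. Qed.

Definition jacobian_mx (R : realType) k m (f : 'rV[R]_k -> 'rV[R]_m) w : 'M[R]_(k, m) :=
  \matrix_(l, j) 'D_('e_l) f w 0 j.

Lemma jacobian_mxE (R : realType) k m (f : 'rV[R]_k -> 'rV[R]_m) w c :
  differentiable f w -> 'd f w c = c *m jacobian_mx f w.
Proof.
move=> df; rewrite {1}[c]row_sum_delta linear_sum; apply/rowP => j.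
rewrite summxE mxE; apply: eq_bigr => l _.
by rewrite linearZ/= !mxE (deriveE _ df).
Qed.

Definition gradient_mx (R : realType) k (f : 'rV[R]_k -> R^o) w : 'cV[R]_k :=
  \col_l 'D_('e_l) f w.

Lemma gradient_mxE (R : realType) k (f : 'rV[R]_k -> R^o) w c :
  differentiable f w -> 'd f w c = (c *m gradient_mx f w) 0 0.
Proof.
move=> df; rewrite {1}[c]row_sum_delta linear_sum mxE; apply: eq_bigr => l _.
by rewrite linearZ/= mxE (deriveE _ df).
Qed.

Section Smoothness.
Context {R : realType} {n k : nat} (S : constrained_system R n k k).
Hypothesis transverse : forall x : cs_sub S, (perp x :&: tangent_sub x)%VS = 0%VS.
Local Notation M := (cs_sub S).
Local Notation V := 'rV[R]_(1 + n * 2).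
Local Notation eta := (contact_form S).

(** Everything is expressed in the charts selected at [x] and at its image [p];
    [psi], [iota], [A], [B], [J] and [F] are the coordinate expressions of the
    parametrization of the submanifold, of its inclusion, of [eta], of [d eta],
    of the differential of the inclusion and of a frame of the constraint
    bundle. *)
Section Near.
Variables (x : M) (U : set M) (s : 'I_k -> M -> V).
Local Notation p := (incl S x).
Hypotheses (oU : open U) (sU : U `<=` incl S @^-1` chart_dom (chart_at p)).
Hypothesis smooth_frame : forall j,
  smooth_fun_on U (fun y => tchange (incl S y) p (incl S y) (s j y)).
Hypothesis frame :
  forall y, U y -> basis_of (cs_bundle S y) [seq s j y | j <- enum 'I_k].

Let psi := chart_inv (chart_at x).
Let O : set 'rV[R]_k := chart_cod (chart_at x) `&` psi @^-1` U.
Let iota : 'rV[R]_k -> V := chart_map (chart_at p) \o incl S \o psi.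

Let A w : 'cV[R]_(1 + n * 2) := \col_j form_in_chart eta p 'e_j (iota w).
Let B w : 'M[R]_(1 + n * 2) :=
  \matrix_(i, j) dform_in_chart eta p (iota w) 'e_i 'e_j.
Let J w := jacobian_mx iota w.
Let F w : 'M[R]_(k, 1 + n * 2) :=
  \matrix_j tchange (incl S (psi w)) p (incl S (psi w)) (s j (psi w)).
Let G w := flat_matrix (B w) (A w).
Let N w := cproj_matrix (G w) (J w) (F w).

Let oO : open O. Proof. exact: open_chart_preimage. Qed.

Let iota_cod w : O w -> chart_cod (chart_at p) (iota w).
Proof. by move=> [_ /sU]; exact: chart_cod_map. Qed.

Let smooth_iota : smooth_on O iota.
Proof.
have [[_ /(_ x)] + _ _ _] := incl_embedding S.
by apply: smooth_on_sub => w [cw /sU].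
Qed.

Let smooth_A : smooth_mx O A.
Proof.
move=> j i; apply: (@smooth_on_eq _ _ _ _ (form_in_chart eta p 'e_j \o iota)) => //.
  by move=> w _; rewrite mxE.
by apply: (smooth_on_comp oO iota_cod smooth_iota); exact: contact_form_smooth.
Qed.

Let smooth_B : smooth_mx O B.
Proof.
move=> i j; apply: (@smooth_on_eq _ _ _ _
  (fun w => ('D_('e_i) (form_in_chart eta p 'e_j) \o iota) w -
            ('D_('e_j) (form_in_chart eta p 'e_i) \o iota) w : R^o)) => //.
  by move=> w _; rewrite mxE.
by apply: smooth_onB => //; apply: (smooth_on_comp oO iota_cod smooth_iota);
  apply: smooth_on_derive; exact: contact_form_smooth.
Qed.

Let smooth_J : smooth_mx O J.
Proof.
move=> l j; apply: (@smooth_on_eq _ _ _ _ (fun w => 'D_('e_l) iota w 0 j)) => //.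
  by move=> w _; rewrite mxE.
by apply: smooth_on_coord => //; exact: smooth_on_derive.
Qed.

Let smooth_F : smooth_mx O F.
Proof.
move=> j l.
apply: smooth_on_eq (smooth_on_coord 0 l oO (smooth_frame j x)) => // w _.
by rewrite mxE.
Qed.

Section AtPoint.
Variable w : 'rV[R]_k.
Hypothesis Ow : O w.
Let y := psi w.
Let q := incl S y.

Let domy : chart_dom (chart_at x) y. Proof. by have [] := chart_invK Ow.1. Qed.
Let mapy : chart_map (chart_at x) y = w. Proof. by have [] := chart_invK Ow.1. Qed.
Let domq : chart_dom (chart_at p) q. Proof. exact: sU Ow.2. Qed.

Let TK : cancel (tchange q p q) (tchange p q q).
Proof. by move=> v; apply: tchangeK => //; exact: mem_chart_at. Qed.

Let TK' : cancel (tchange p q q) (tchange q p q).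
Proof. by move=> v; apply: tchangeK => //; exact: mem_chart_at. Qed.

Let tK' : cancel (tchange x y y) (tchange y x y).
Proof. by move=> v; apply: tchangeK => //; exact: mem_chart_at. Qed.

Let smooth_eta := @contact_form_smooth _ _ S.

Let dformE u v :
  dform eta q u v = (tchange q p q u *m B w *m (tchange q p q v)^T) 0 0.
Proof.
rewrite (dform_change smooth_eta _ _ domq).
have cz := chart_cod_map domq.
apply: (bilinear_mx (b := dform_in_chart eta p (iota w))) => *.
  exact: dform_in_chart_linear.
exact: dform_in_chart_linearr.
Qed.

Let etaE v : eta q v = (tchange q p q v *m A w) 0 0.
Proof.
rewrite (form_change eta v domq) form_in_chart_sum mxE.
by apply: eq_bigr => j _; rewrite mxE.
Qed.

Let mdiffE c :
  tchange q p q (mdiff (incl S) y c) = tchange y x y c *m J w.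
Proof.
have [si _ _ _] := incl_embedding S.
rewrite (mdiff_change c si domy domq) mapy; apply: jacobian_mxE.
exact: smooth_on_differentiable smooth_iota Ow.
Qed.

Let mdfE (f : M -> R^o) c : Cinf f ->
  mdf f y c = (tchange y x y c *m gradient_mx (f \o psi) w) 0 0.
Proof.
move=> sf; rewrite (mdf_change c sf domy) mapy; apply: gradient_mxE.
by apply: smooth_on_differentiable (sf x) _; split=> //; exact: Ow.1.
Qed.

Let mdiff_inj : lker (mdiff (incl S) y) = 0%VS.
Proof. by have [_ /(_ y)] := incl_embedding S. Qed.

Lemma G_unit_near : G w \in unitmx.
Proof. exact: flat_mx_unit TK' dformE etaE. Qed.

Lemma pairing_unit_near : pairing_matrix (G w) (J w) (F w) \in unitmx.
Proof.
exact: (pairing_unit (s := s ^~ y) TK TK' tK' dformE etaE mdiffE mdiff_inj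
  (frame Ow.2) (transverse y)).
Qed.

(** The left-hand side uses components in the charts selected at the moving
    points [y] and [q]; the components in the fixed charts are related to them by
    [tchange], and the changes of components cancel. *)
Lemma nh_bracket_near f g : Cinf f -> Cinf g -> nh_bracket f g y =
  - (((N w *m gradient_mx (f \o psi) w)^T *m invmx (G w)) *m B w *m
     ((N w *m gradient_mx (g \o psi) w)^T *m invmx (G w))^T) 0 0
  - f y * ((A w)^T *m invmx (G w) *m N w *m gradient_mx (g \o psi) w) 0 0
  + g y * ((A w)^T *m invmx (G w) *m N w *m gradient_mx (f \o psi) w) 0 0.
Proof.
move=> sf sg.
exact: (nh_bracket_mx (s := s ^~ y) TK TK' tK' dformE etaE mdiffE mdiff_inj
  (frame Ow.2) (transverse y) (fun c => mdfE c sf) (fun c => mdfE c sg)).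
Qed.

End AtPoint.

Lemma nh_bracket_smooth_near f g : Cinf f -> Cinf g ->
  smooth_on O (nh_bracket f g \o psi).
Proof.
move=> sf sg.
have sc h : Cinf h -> smooth_on O (h \o psi).
  by move=> /(_ x); apply: smooth_on_sub => w [].
have sd h : Cinf h -> smooth_mx O (gradient_mx (h \o psi)).
  move=> sh l i; apply: smooth_on_eq (smooth_on_derive 'e_l (sc _ sh)) => // w _.
  by rewrite mxE.
have sG : smooth_mx O G.
  apply: smooth_mxD => //; apply: smooth_mxM => //; exact: smooth_mxT.
have sGV : smooth_mx O (fun w => invmx (G w)).
  by apply: smooth_mxV => // w; exact: G_unit_near.
have sP : smooth_mx O (fun w => pairing_matrix (G w) (J w) (F w)).
  by apply: smooth_mxM => //; [apply: smooth_mxM|apply: smooth_mxT].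
have sN : smooth_mx O N.
  apply: smooth_mxM => //; first by apply: smooth_mxM => //; exact: smooth_mxT.
  by apply: smooth_mxV => // w; exact: pairing_unit_near.
have sdf := sd _ sf; have sdg := sd _ sg.
apply: smooth_on_eq; first exact: oO.
  by move=> w Ow; exact: esym (nh_bracket_near Ow sf sg).
apply: smooth_onD => //; last first.
  apply: smooth_onM => //; first exact: sc.
  apply: smooth_on_of_mx.
  by do !(apply: smooth_mxM => //); apply: smooth_mxT.
apply: smooth_onB => //; last first.
  apply: smooth_onM => //; first exact: sc.
  apply: smooth_on_of_mx.
  by do !(apply: smooth_mxM => //); apply: smooth_mxT.
apply: smooth_onN => //; apply: smooth_on_of_mx.
have sNd h : smooth_mx O (gradient_mx (h \o psi)) ->
    smooth_mx O (fun w => (N w *m gradient_mx (h \o psi) w)^T *m invmx (G w)).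
  move=> sh; apply: smooth_mxM => //; apply: smooth_mxT => //.
  exact: smooth_mxM.
apply: smooth_mxM => //; first by apply: smooth_mxM => //; exact: sNd.
by apply: smooth_mxT => //; exact: sNd.
Qed.

End Near.

Lemma nh_bracket_smooth (f g : M -> R^o) : Cinf f -> Cinf g -> Cinf (nh_bracket f g).
Proof.
move=> sf sg; apply: smooth_near_centres => x.
have [U [s [oU Ux sU smooth_frame frame]]] := cs_bundle_sub (c := S) x.
exists (chart_cod (chart_at x) `&` chart_inv (chart_at x) @^-1` U); split.
- exact: open_chart_preimage.
- have dx := mem_chart_at x.
  by split; [exact: chart_cod_map|rewrite /= chart_mapKE].
- exact: (nh_bracket_smooth_near oU sU smooth_frame frame).
Qed.

End Smoothness.

Theorem proposition4 (R : realType) (n k r : nat)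
    (S : constrained_system R n k r)
    (mech : mechanical S)
    (transverse : forall x : cs_sub S, (perp x :&: tangent_sub x)%VS = 0%VS)
    (rankF : r = k) :
  almost_lie_algebra (@Cinf R k (cs_sub S)) (@nh_bracket R n k r S) /\
  forall f g h : cs_sub S -> R^o, Cinf f -> Cinf g -> Cinf h ->
    forall x : cs_sub S,
      nh_bracket f (g \* h) x
      = g x * nh_bracket f h x + h x * nh_bracket f g x
        - g x * h x * reebHM_der f x.
Proof.
subst r; split; last by move=> f g h sf sg sh x; exact: nh_bracket_leibniz.
split.
- by move=> f g; exact: nh_bracket_smooth.
- by move=> a f g h; exact: nh_bracket_lincomb.
- move=> a f g h sf sg sh; rewrite ![nh_bracket f _]nh_bracket_skew.
  by rewrite nh_bracket_lincomb// opprD scalerN.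
- by move=> f g _ _; exact: nh_bracket_skew.
Qed.
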